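(* Let $X=(\mathbb{C}^* )^n$ with the complete metric $g=\frac12\sum_i\left(\frac{dz_i}{z_i}\otimes\frac{d\bar z_i}{\bar z_i}+\frac{d\bar z_i}{\bar z_i}\otimes\frac{dz_i}{z_i}\right)$, and let $f:X\to\mathbb{C}$ be a convenient non-degenerate Laurent polynomial. Then $(X,g)$ has bounded geometry and $(X,g,f)$ satisfies the strongly elliptic condition: for every $\epsilon>0$ and every integer $k\ge2$, $$\epsilon|\nabla f(z)|^k-|\nabla^kf(z)|\to+\infty\quad\text{as } d(z,z_0)\to\infty,$$ where $z_0\in X$ is a fixed point and $d$ is the distance of $g$.
   Context: $\nabla$ is the Levi-Civita connection of $g$ and $|\cdot|$ the pointwise norm induced by $g$. $(X,g)$ has bounded geometry if $g$ is complete, the injectivity radius is positive, and all covariant derivatives of the curvature tensor are uniformly bounded. Write $f=\sum_{\alpha\in\mathbb{Z}^n}c_\alpha z^\alpha$ (finite sum), $z^\alpha=z_1^{\alpha_1}\cdots z_n^{\alpha_n}$. The Newton polytope $\triangle(f)\subset\mathbb{R}^n$ is the convex hull of $\{\alpha: c_\alpha\ne0\}$. $f$ is convenient if $0$ lies in the interior of $\triangle(f)$. For a face $\triangle'$ (of any dimension) of $\triangle(f)$ put $f^{\triangle'}=\sum_{\alpha\in\triangle'}c_\alpha z^\alpha$ and $f_i^{\triangle'}=z_i\frac{\partial}{\partial z_i}f^{\triangle'}$. $f$ is non-degenerate if for every face $\triangle'$ of $\triangle(f)$ the equations $f^{\triangle'}(z)=f_1^{\triangle'}(z)=\cdots=f_n^{\triangle'}(z)=0$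 have no common solution on $X$. *)

(* Defs.v *)
From HB Require Import structures.
From mathcomp Require Export all_boot all_order all_algebra finmap.
From mathcomp Require Export all_classical all_reals all_analysis.
From mathcomp Require Export complex.

Set Implicit Arguments.
Unset Strict Implicit.
Unset Printing Implicit Defensive.

Export Order.TTheory GRing.Theory Num.Theory.
Export numFieldNormedType.Exports.

#[export] Set Implicit Arguments.
#[export] Unset Strict Implicit.
#[export] Unset Printing Implicit Defensive.

Local Open Scope classical_set_scope.
Local Open Scope ring_scope.

(** * Riemannian geometry on a domain [U] of R^m

    The manifold is an open subset [U] of R^m with its global coordinates;
    [g p] is the Gram matrix of the metric at [p] in the coordinate frame.
    A covariant [k]-tensor field is the family of its components in the
    coordinate frame. *)

Section RiemannianDomain.
Variables (R : realType) (m : nat).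
Local Notation V := 'rV[R]_m.
Local Notation tensor k := (k.-tuple 'I_m -> V -> R).

Implicit Types (U : set V) (g : V -> 'M[R]_m) (p q v : V).

Definition pderiv (a : 'I_m) (h : V -> R) : V -> R :=
  fun p => derive h p (delta_mx 0 a).

(** Christoffel symbols of the second kind,
    [christoffel g c a b] being Gamma^c_{ab}. *)
Definition christoffel g (c a b : 'I_m) : V -> R := fun p =>
  2^-1 * \sum_(d < m) invmx (g p) c d *
    (pderiv a (fun q => g q b d) p + pderiv b (fun q => g q a d) p
     - pderiv d (fun q => g q a b) p).

(** The Levi-Civita derivative of a covariant tensor field; the direction of
    differentiation is the first slot:
    (nabla T)_{a s} = d_a T_s - sum_j sum_c Gamma^c_{a s_j} T_{s[j := c]}. *)
Definition covD g k (T : tensor k) : tensor k.+1 := fun s p =>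
  let a := thead s in
  let s' := [tuple of behead s] in
  pderiv a (T s') p
  - \sum_(j < k) \sum_(c < m) christoffel g c a (tnth s' j) p *
      T [tuple (if i == j then c else tnth s' i) | i < k] p.

Fixpoint iter_covD g (l : nat) k (T : tensor k) : tensor (l + k) :=
  match l return tensor (l + k) with
  | 0 => T
  | l'.+1 => covD g (@iter_covD g l' k T)
  end.
Arguments iter_covD g l {k} T.

Definition scalar_tensor (h : V -> R) : tensor 0 := fun _ => h.

Definition tensor_normsq g k (T : tensor k) p : R :=
  \sum_(s : k.-tuple 'I_m) \sum_(t : k.-tuple 'I_m)
    (\prod_(j < k) invmx (g p) (tnth s j) (tnth t j)) * T s p * T t p.

Definition tensor_norm g k (T : tensor k) p : R :=
  Num.sqrt (tensor_normsq g T p).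

(** |nabla^k f| for a complex-valued [f], in the Hermitian extension of [g]:
    |T|^2 = |Re T|^2 + |Im T|^2. *)
Definition nabla_norm g (k : nat) (f : V -> R[i]) p : R :=
  Num.sqrt
    (tensor_normsq g (iter_covD g k (scalar_tensor (fun q => complex.Re (f q)))) p
   + tensor_normsq g (iter_covD g k (scalar_tensor (fun q => complex.Im (f q)))) p).

(** R^d_{cab}, the [d]-component of the curvature R(e_a, e_b) e_c. *)
Definition curvature g (d c a b : 'I_m) : V -> R := fun p =>
  pderiv a (christoffel g d b c) p - pderiv b (christoffel g d a c) p
  + \sum_(e < m) (christoffel g d a e p * christoffel g e b c p
                  - christoffel g d b e p * christoffel g e a c p).

Definition curvature_tensor g : tensor 4 := fun s p =>
  \sum_(e < m) g p (tnth s 0) e *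
    curvature g e (tnth s 1) (tnth s 2) (tnth s 3) p.

Definition gnorm g p v : R := Num.sqrt ((v *m g p *m v^T) 0 0).

(** A C^1 curve on [0, 1] is given by a C^1 extension to the whole line, of
    which only the restriction to [0, 1] has to stay in [U]. *)
Definition C1_curve U (gamma : R -> V) : Prop :=
  [/\ forall t, derivable gamma t 1,
      continuous (derive1 gamma)
    & forall t, t \in `[0, 1] -> U (gamma t)].

Definition curve_length g (gamma : R -> V) : \bar R :=
  (\int[lebesgue_measure]_(t in `[0%R, 1%R])
     (gnorm g (gamma t) (derive1 gamma t))%:E)%E.

(** [joined U g p q l]: some piecewise C^1 curve in [U], i.e. a finite
    concatenation of C^1 curves, goes from [p] to [q] and has length [l]. *)
Inductive joined U g : V -> V -> \bar R -> Prop :=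
| joined_refl p : U p -> joined U g p p 0%E
| joined_cons (gamma : R -> V) q l :
    C1_curve U gamma -> joined U g (gamma 1) q l ->
    joined U g (gamma 0) q (curve_length g gamma + l)%E.

Definition dist U g p q : \bar R := ereal_inf [set l | joined U g p q l].

Definition complete_metric U g : Prop :=
  forall u : nat -> V, (forall i, U (u i)) ->
    (forall e : R, 0 < e -> exists N, forall i j, (N <= i)%N -> (N <= j)%N ->
       (dist U g (u i) (u j) < e%:E)%E) ->
    exists2 p, U p &
      forall e : R, 0 < e -> exists N, forall i, (N <= i)%N ->
        (dist U g (u i) p < e%:E)%E.

Definition geodesic U g (gamma : R -> V) : Prop :=
  forall t, t \in `[0, 1] ->
    [/\ U (gamma t), derivable gamma t 1, derivable (derive1 gamma) t 1 &
        forall c : 'I_m,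
          derive1 (derive1 gamma) t 0 c
          + \sum_(a < m) \sum_(b < m) christoffel g c a b (gamma t)
              * derive1 gamma t 0 a * derive1 gamma t 0 b = 0].

(** The graph of the exponential map at [p]: exp_p v is defined and equal
    to [q]. *)
Definition is_exp U g p v q : Prop :=
  exists gamma : R -> V,
    [/\ geodesic U g gamma, gamma 0 = p, derive1 gamma 0 = v & gamma 1 = q].

Definition pderivs (s : seq 'I_m) (h : V -> R) : V -> R := foldr pderiv h s.

(** C^infinity on an open set [A]: all iterated partial derivatives exist and
    are continuous on [A]. *)
Definition smooth_on (A : set V) (F : V -> V) : Prop :=
  forall (c : 'I_m) (s : seq 'I_m) (x : V), A x ->
    let h := pderivs s (fun y => F y 0 c) in
    {for x, continuous h} /\ forall a : 'I_m, derivable h x (delta_mx 0 a).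

Definition diffeo_on_image (A : set V) (F : V -> V) : Prop :=
  [/\ open A, open (F @` A), smooth_on A F &
      exists2 G : V -> V, smooth_on (F @` A) G & {in A, cancel F G}].

Definition exp_diffeo_on_ball U g p (r : R) : Prop :=
  exists2 E : V -> V,
    (forall v, gnorm g p v < r -> is_exp U g p v (E v)) &
    diffeo_on_image [set v | gnorm g p v < r] E.

Definition injectivity_radius_at U g p : \bar R :=
  ereal_sup [set r%:E | r in [set r : R | 0 < r /\ exp_diffeo_on_ball U g p r]].

Definition injectivity_radius U g : \bar R :=
  ereal_inf [set injectivity_radius_at U g p | p in U].

Definition bounded_geometry U g : Prop :=
  [/\ complete_metric U g,
      (0 < injectivity_radius U g)%E &
      forall l : nat, exists C : R, forall p, U p ->
        tensor_norm g (iter_covD g l (curvature_tensor g)) p <= C].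

Definition strongly_elliptic U g (f : V -> R[i]) : Prop :=
  forall (eps : R) (k : nat) (z0 : V), 0 < eps -> (2 <= k)%N -> U z0 ->
    forall M : R, exists D : R, forall z, U z ->
      (D%:E < dist U g z z0)%E ->
      M < eps * nabla_norm g 1 f z ^+ k - nabla_norm g k f z.

End RiemannianDomain.

(** * The complex torus (C^* )^n as a domain of R^(2n)

    The point with coordinates z_j = x_j + i y_j is the row vector
    (x_1, ..., x_n, y_1, ..., y_n). *)

Section Torus.
Variables (R : realType) (n : nat).
Local Notation V := 'rV[R]_(n + n).

Definition zcoord (j : 'I_n) (p : V) : R[i] :=
  Complex (p 0 (lshift n j)) (p 0 (rshift n j)).

Definition torus : set V := [set p | forall j, zcoord j p != 0].

(** The form dz_j / z_j at [p], evaluated on the tangent vector [v]; as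
    [zcoord j] is R-linear, dz_j is [zcoord j] itself. *)
Definition dlogz (p : V) (j : 'I_n) (v : V) : R[i] := zcoord j v / zcoord j p.

(** The sum below is real, so that [complex.Re] only changes its type. *)
Definition torus_metric (p : V) : 'M[R]_(n + n) :=
  \matrix_(a, b)
    let e c : V := delta_mx 0 c in
    complex.Re (2^-1 * \sum_(j < n)
      (dlogz p j (e a) * conjc (dlogz p j (e b))
       + conjc (dlogz p j (e a)) * dlogz p j (e b))).

(** The Wirtinger derivative d/dz_j = (d/dx_j - i d/dy_j) / 2. *)
Definition dz (j : 'I_n) (f : V -> R[i]) (p : V) : R[i] :=
  let d a : R[i] := Complex (pderiv a (fun q => complex.Re (f q)) p)
                            (pderiv a (fun q => complex.Im (f q)) p) in
  2^-1 * (d (lshift n j) - 'i%C * d (rshift n j)).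

End Torus.

Section Laurent.
Variables (R : realType) (n : nat).
Local Notation V := 'rV[R]_(n + n).

(** A Laurent polynomial is the finitely supported family of its
    coefficients c_alpha, alpha in Z^n. *)
Definition laurent := {fsfun 'rV[int]_n -> R[i] with 0}.

Implicit Type c : laurent.

Definition laurent_eval c (p : V) : R[i] :=
  \sum_(alpha <- finsupp c) c alpha * \prod_(j < n) zcoord j p ^ alpha 0 j.

Definition lattice_pt (alpha : 'rV[int]_n) : 'rV[R]_n :=
  map_mx intr alpha.

Definition newton_polytope c : set 'rV[R]_n :=
  [set x | exists w : 'rV[int]_n -> R,
     [/\ forall alpha, 0 <= w alpha,
         \sum_(alpha <- finsupp c) w alpha = 1 &
         x = \sum_(alpha <- finsupp c) w alpha *: lattice_pt alpha]].

Definition convenient c : Prop := interior (newton_polytope c) 0.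

(** The nonempty faces of a polytope [P], [P] itself included ([u] = 0): the
    sets of maximizers over [P] of the linear functionals. *)
Definition is_face (P F : set 'rV[R]_n) : Prop :=
  F !=set0 /\
  exists u : 'rV[R]_n,
    F = [set x | P x /\ forall y, P y -> (y *m u^T) 0 0 <= (x *m u^T) 0 0].

Definition face_part c (F : set 'rV[R]_n) : laurent :=
  [fsfun alpha in finsupp c =>
     if `[< F (lattice_pt alpha) >] then c alpha else 0 | 0].

Definition nondegenerate c : Prop :=
  forall F, is_face (newton_polytope c) F ->
    ~ exists z : V,
        [/\ torus z,
            laurent_eval (face_part c F) z = 0 &
            forall j, zcoord j z * dz j (laurent_eval (face_part c F)) z = 0].

End Laurent.

(* Main.v *)
Require Import Defs.
From mathcomp Require Import ring lra.

(* In the logarithmic coordinates w_j = log z_j the metric is the flat metric of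
   C^n / (2 pi i Z)^n.  The real and imaginary parts of the dz_j / z_j form a
   closed orthonormal coframe, hence a parallel one: the curvature vanishes, and
   covariant derivatives of a function are iterated derivatives along the dual
   frame, which multiply z^alpha by alpha_j or i alpha_j.  The curves
   z_j exp(t w_j) are geodesics, and their lengths bound distances from above;
   conversely log|z_j| is 1-Lipschitz, so that a Cauchy sequence stays in a
   compact product of annuli.

   Let S(z) be the sum of the |z^alpha| over the support of f.  Then
   |nabla^k f| <= C_k S, and S tends to infinity because 0 is interior to the
   Newton polytope; as k >= 2 it suffices that |nabla f| >= c S near infinity.
   If this fails, take a sequence of points going to infinity with
   |nabla f| = o(S), an ultrafilter along it, and the set A' of the exponents
   alpha with S = O(|z^alpha|).  The vector log|z| is u + y, where y is bounded
   and alpha.u takes a constant value m on A'; moreover alpha.u < m off A', and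
   m > 0.  So A' spans a face, and |nabla f| / S is bounded below, up to o(1),
   by the derivatives of the facial polynomial at points with moduli exp(y);
   those are bounded away from 0 by compactness, non-degeneracy and Euler's
   identity. *)

Local Open Scope classical_set_scope.
Local Open Scope ring_scope.

Local Notation Re := complex.Re.
Local Notation Im := complex.Im.
Import ComplexField.Normc.

(** * Complex numbers and complex-valued derivatives *)

Section ComplexNumbers.
Variable R : realType.
Implicit Types (x y z : R[i]) (a : R).

Lemma complex_ext x y : Re x = Re y -> Im x = Im y -> x = y.
Proof. by case: x => ? ?; case: y => ? ? /= -> ->. Qed.

Lemma ReD x y : Re (x + y) = Re x + Re y. Proof. by case: x; case: y. Qed.
Lemma ImD x y : Im (x + y) = Im x + Im y. Proof. by case: x; case: y. Qed.
Lemma ReN x : Re (- x) = - Re x. Proof. by case: x. Qed.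
Lemma ImN x : Im (- x) = - Im x. Proof. by case: x. Qed.
Lemma ReM x y : Re (x * y) = Re x * Re y - Im x * Im y.
Proof. by case: x; case: y. Qed.
Lemma ImM x y : Im (x * y) = Re x * Im y + Im x * Re y.
Proof. by case: x; case: y. Qed.
Lemma Re_sum (I : Type) (r : seq I) (P : pred I) (F : I -> R[i]) :
  Re (\sum_(i <- r | P i) F i) = \sum_(i <- r | P i) Re (F i).
Proof. exact: (big_morph _ ReD). Qed.
(** Turns each summand of [torus_metric] into a real inner product, so that the metric is the Gram
    matrix of the rows of [coframe]. *)
Lemma Re_polarization x y :
  Re (2^-1 * (x * conjc y + conjc x * y)) = Re x * Re y + Im x * Im y.
Proof.
have -> : x * conjc y + conjc x * y = 2 * Complex (Re x * Re y + Im x * Im y) 0.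
  rewrite mulr_natl mulr2n; case: x y => [? ?] [? ?].
  by apply: complex_ext => /=; ring.
by rewrite mulKf // pnatr_eq0.
Qed.

(** The squared modulus as a real number: polynomial in the two parts, hence differentiable
    everywhere, unlike [normc]. *)
Definition nsq z : R := Re z ^+ 2 + Im z ^+ 2.

Lemma nsq_ge0 z : 0 <= nsq z. Proof. by rewrite addr_ge0 ?sqr_ge0. Qed.

Lemma nsqM x y : nsq (x * y) = nsq x * nsq y.
Proof. rewrite /nsq ReM ImM; ring. Qed.

Lemma nsq_eq0 z : (nsq z == 0) = (z == 0).
Proof.
by rewrite /nsq paddr_eq0 ?sqr_ge0 // !sqrf_eq0 eq_complex.
Qed.

Lemma nsq_gt0 z : (0 < nsq z) = (z != 0).
Proof. by rewrite lt_def nsq_ge0 nsq_eq0 andbT. Qed.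

Lemma ReV z : Re z^-1 = Re z / nsq z. Proof. by case: z. Qed.
Lemma ImV z : Im z^-1 = - Im z / nsq z. Proof. by case: z => a b; rewrite mulNr. Qed.

Lemma normc_sqrt z : normc z = Num.sqrt (nsq z). Proof. by case: z. Qed.
Lemma normc_ge0 z : 0 <= normc z. Proof. by rewrite normc_sqrt sqrtr_ge0. Qed.
Lemma normc_gt0 z : (0 < normc z) = (z != 0).
Proof. by rewrite normc_sqrt sqrtr_gt0 nsq_gt0. Qed.
Lemma normc_sqr z : normc z ^+ 2 = nsq z.
Proof. by rewrite normc_sqrt sqr_sqrtr ?nsq_ge0. Qed.

Lemma normc_realC a : normc a%:C%C = `|a|.
Proof. by rewrite normc_sqrt /nsq /= expr0n addr0 sqrtr_sqr. Qed.

Lemma normc_sum (I : Type) (r : seq I) (P : pred I) (F : I -> R[i]) :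
  normc (\sum_(i <- r | P i) F i) <= \sum_(i <- r | P i) normc (F i).
Proof.
elim/big_ind2 : _ => [|x a y b xa yb|//]; first by rewrite normc0.
exact: le_trans (le_normcD _ _) (lerD xa yb).
Qed.

Lemma normc_prod (I : Type) (r : seq I) (P : pred I) (F : I -> R[i]) :
  normc (\prod_(i <- r | P i) F i) = \prod_(i <- r | P i) normc (F i).
Proof. by apply: (big_morph (@normc R) (@normcM R)); rewrite normc1. Qed.

Lemma normcXz z (m : int) : normc (z ^ m) = normc z ^ m.
Proof.
have X k : normc (z ^+ k) = normc z ^+ k.
  by elim: k => [|k IH]; rewrite ?expr0 ?normc1 // !exprS normcM IH.
by case: m => k; rewrite ?NegzE -?exprnN -?exprnP ?normcV X.
Qed.

Definition cexp z : R[i] :=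
  Complex (expR (Re z) * cos (Im z)) (expR (Re z) * sin (Im z)).
(* The principal branch, meaningful only for [0 < Re z]. *)
Definition clog z : R[i] :=
  Complex (ln (nsq z) / 2) (atan (Im z / Re z)).

Lemma cexp0 : cexp 0 = 1.
Proof. by rewrite /cexp /= expR0 cos0 sin0 mul1r mulr0. Qed.

Lemma nsq_cexp z : nsq (cexp z) = expR (Re z) ^+ 2.
Proof. by rewrite /nsq /= !exprMn -mulrDr cos2Dsin2 mulr1. Qed.

Lemma cexp_neq0 z : cexp z != 0.
Proof. by rewrite -nsq_eq0 nsq_cexp sqrf_eq0 gt_eqF ?expR_gt0. Qed.

Lemma clogK z : 0 < Re z -> cexp (clog z) = z.
Proof.
move=> z0; have n0 : 0 < nsq z.
  by rewrite nsq_gt0; apply: contraTneq z0 => ->; rewrite ltxx.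
rewrite /cexp /clog /=.
(* Nonnegative reals are identified through their squares, here and for the cosine below. *)
have e : expR (ln (nsq z) / 2) = Num.sqrt (nsq z).
  apply: (@pexpIrn _ 2) => //; rewrite ?nnegrE ?expR_ge0 ?sqrtr_ge0 //.
  rewrite -expRM_natl sqr_sqrtr ?nsq_ge0 // -[RHS]lnK //.
  by congr expR; rewrite -mulr_natl mulrC divfK.
have c0 : 0 < cos (atan (Im z / Re z)) by rewrite cos_gt0_pihalf // atan_gtNpi2 atan_ltpi2.
have ce : Num.sqrt (nsq z) * cos (atan (Im z / Re z)) = Re z.
  apply: (@pexpIrn _ 2) => //; rewrite ?nnegrE ?mulr_ge0 ?sqrtr_ge0 ?ltW //.
  rewrite exprMn sqr_sqrtr ?nsq_ge0 //.
  have := cos2_tan2 (lt0r_neq0 c0); rewrite atanK => h.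
  have -> : cos (atan (Im z / Re z)) ^+ 2 = (1 + (Im z / Re z) ^+ 2)^-1.
    by rewrite -[LHS]invrK h.
  rewrite /nsq; field; rewrite gt_eqF //=.
  by rewrite gt_eqF // ltr_pwDl ?exprn_gt0 ?sqr_ge0.
have se : sin (atan (Im z / Re z)) = Im z / Re z * cos (atan (Im z / Re z)).
  by rewrite -{2}[Im z / Re z]atanK /tan divfK // gt_eqF.
apply: complex_ext; rewrite /= e //.
by rewrite se mulrCA ce divfK // gt_eqF.
Qed.

(** On this strip the cosine of [Im z] is positive, and [atan] inverts [tan]. *)
Lemma cexpK z : `|Im z| < pi / 2 -> clog (cexp z) = z.
Proof.
move=> hz; rewrite /clog nsq_cexp lnXn ?expR_gt0 // expRK.
have c0 : 0 < cos (Im z) by rewrite cos_gt0_pihalf // -ltr_norml.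
apply: complex_ext => /=; first by rewrite mulr2n; field.
rewrite -mulf_div divff ?gt_eqF ?expR_gt0 // mul1r -/(tan _).
by rewrite tanK // in_itv /= -ltr_norml.
Qed.

Lemma Re_cexp_gt0 z : `|Im z| < pi / 2 -> 0 < Re (cexp z).
Proof.
by move=> hz /=; rewrite mulr_gt0 ?expR_gt0 // cos_gt0_pihalf // -ltr_norml.
Qed.

(** Divided by its modulus, the point lies on the unit circle; [acos] of the abscissa, with the sign
    of the ordinate, is an argument in [-pi, pi]. This bound makes the angular contribution to
    distances uniform. *)
Lemma polar_log z : z != 0 ->
  exists w, [/\ cexp w = z, Re w = ln (normc z) & `|Im w| <= pi].
Proof.
move=> z0; have m0 : 0 < normc z by rewrite normc_gt0.
pose x := Re z / normc z; pose y := Im z / normc z.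
have xy : x ^+ 2 + y ^+ 2 = 1.
  rewrite !exprMn -mulrDl -/(nsq z) -normc_sqr exprVn divff //.
  by rewrite expf_neq0 // gt_eqF.
have x1 : -1 <= x <= 1.
  rewrite -ler_norml -(@ler_pXn2r _ 2) ?nnegrE // expr1n real_normK ?num_real //.
  by rewrite -xy lerDl sqr_ge0.
have sx : Num.sqrt (1 - x ^+ 2) = `|y|.
  by rewrite -xy addrC addKr sqrtr_sqr.
exists (Complex (ln (normc z)) (if 0 <= y then acos x else - acos x)).
split=> //=; last first.
  by case: ifP => _; rewrite ?normrN ger0_norm ?acos_ge0 ?acos_lepi.
apply: complex_ext => /=; rewrite lnK ?posrE //.
  by case: ifP => _; rewrite ?cosN acosK ?in_itv //= /x mulrC divfK ?gt_eqF.
case: ifP => y0; rewrite ?sinN sin_acos // sx.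
  by rewrite ger0_norm // mulrC divfK ?gt_eqF.
by rewrite ltr0_norm ?opprK 1?mulrC ?divfK ?gt_eqF // ltNge y0.
Qed.

End ComplexNumbers.

Section ComplexDerivative.
Variables (R : realType) (W : normedModType R).
Implicit Types (F G : W -> R[i]) (p v : W) (l : R[i]).

(** Restriction to the line through [p] makes the one-variable chain rule available on a normed
    space. *)
Lemma is_derive_line (h : W -> R) p v (d : R) :
  is_derive p v h d <-> is_derive (0 : R) 1 (fun t => h (t *: v + p)) d.
Proof.
have e : 'D_v h p = 'D_1 (fun t : R => h (t *: v + p)) 0.
  rewrite /derive; set g1 := fun h => h^-1 *: _; set g2 := fun h => h^-1 *: _.
  suff -> : g1 = g2 by [].
  by rewrite funeqE /g1 /g2 => t /=; rewrite addr0 scale0r add0r [_%:A]mulr1.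
split=> -[h1 h2]; split.
- exact: (derivable1P h p v).1 h1.
- by rewrite -e.
- exact: (derivable1P h p v).2 h1.
- by rewrite e.
Qed.

Lemma is_derive_comp (f : R -> R) (h : W -> R) p v (a b : R) :
  is_derive (h p) 1 f a -> is_derive p v h b ->
  is_derive p v (fun q => f (h q)) (a * b).
Proof.
move=> fa /is_derive_line hb; apply/is_derive_line.
apply: (@is_derive1_comp _ f (fun t => h (t *: v + p))).
by rewrite scale0r add0r.
Qed.

Lemma is_derive_mul (h k : W -> R) p v (a b : R) :
  is_derive p v h a -> is_derive p v k b ->
  is_derive p v (fun q => h q * k q) (h p * b + k p * a).
Proof. by move=> ha kb; have := is_deriveM ha kb. Qed.

Lemma is_derive_add (h k : W -> R) p v (a b : R) :
  is_derive p v h a -> is_derive p v k b ->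
  is_derive p v (fun q => h q + k q) (a + b).
Proof. by move=> ha kb; have := is_deriveD ha kb. Qed.

Lemma is_derive_opp (h : W -> R) p v (a : R) :
  is_derive p v h a -> is_derive p v (fun q => - h q) (- a).
Proof. by move=> ha; have := is_deriveN ha. Qed.

Lemma is_derive_inv (h : W -> R) p v (a : R) : h p != 0 ->
  is_derive p v h a -> is_derive p v (fun q => (h q)^-1) (- (h p) ^- 2 * a).
Proof.
move=> h0 ha; apply: (is_derive_comp _ ha).
by apply: is_derive_eq (is_deriveV h0 (is_derive_id (h p) 1)) _; exact: mulr1.
Qed.

Lemma is_derive_val (h : W -> R) p v (a : R) : is_derive p v h a -> 'D_v h p = a.
Proof. by case. Qed.

Lemma is_derive_near (f g : W -> R) p v (d : R) :
  (\near p, f p = g p) -> is_derive p v f d -> is_derive p v g d.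
Proof. exact: near_eq_is_derive. Qed.

Definition cdiff F p v l :=
  is_derive p v (fun q => Re (F q)) (Re l) /\
  is_derive p v (fun q => Im (F q)) (Im l).

Lemma cdiff_eq F p v l l' : cdiff F p v l -> l = l' -> cdiff F p v l'.
Proof. by move=> ? <-. Qed.

Lemma cdiff_cst (c : R[i]) p v : cdiff (fun=> c) p v 0.
Proof. by split; apply: is_derive_cst. Qed.

Lemma cdiffD F G p v l l' : cdiff F p v l -> cdiff G p v l' ->
  cdiff (fun q => F q + G q) p v (l + l').
Proof.
move=> [f1 f2] [g1 g2]; split; rewrite ?ReD ?ImD.
  by under eq_fun do rewrite ReD; exact: is_derive_add.
by under eq_fun do rewrite ImD; exact: is_derive_add.
Qed.

Lemma cdiffM F G p v l l' : cdiff F p v l -> cdiff G p v l' ->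
  cdiff (fun q => F q * G q) p v (l * G p + F p * l').
Proof.
move=> [f1 f2] [g1 g2]; split.
  under eq_fun do rewrite ReM.
  apply: (is_derive_eq (is_derive_add (is_derive_mul f1 g1) (is_derive_opp (is_derive_mul f2 g2)))).
  rewrite ReD !ReM /GRing.scale /=; ring.
under eq_fun do rewrite ImM.
apply: (is_derive_eq (is_derive_add (is_derive_mul f1 g2) (is_derive_mul f2 g1))).
rewrite ImD !ImM /GRing.scale /=; ring.
Qed.

Lemma cdiffZ (c : R[i]) F p v l : cdiff F p v l ->
  cdiff (fun q => c * F q) p v (c * l).
Proof.
by move=> h; apply: cdiff_eq (cdiffM (cdiff_cst c p v) h) _; rewrite mul0r add0r.
Qed.

Lemma cdiff_sum (I : Type) (r : seq I) (F : I -> W -> R[i]) p v (l : I -> R[i]) :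
  (forall i, cdiff (F i) p v (l i)) ->
  cdiff (fun q => \sum_(i <- r) F i q) p v (\sum_(i <- r) l i).
Proof.
move=> h; elim: r => [|i r IH].
  rewrite big_nil; under [X in cdiff X]eq_fun do rewrite big_nil.
  exact: cdiff_cst.
rewrite big_cons; under [X in cdiff X]eq_fun do rewrite big_cons.
exact: cdiffD.
Qed.

Lemma is_derive_nsq F p v l : cdiff F p v l ->
  is_derive p v (fun q => nsq (F q)) (2 * Re (conjc (F p) * l)).
Proof.
move=> [f1 f2]; apply: (is_derive_eq (is_derive_add (is_derive_mul f1 f1) (is_derive_mul f2 f2))).
by rewrite ReM; case: (F p) => a b; rewrite /GRing.scale /=; ring.
Qed.

Lemma cdiffV F p v l : F p != 0 -> cdiff F p v l ->
  cdiff (fun q => (F q)^-1) p v (- l / F p ^+ 2).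
Proof.
move=> F0 h; have n0 : nsq (F p) != 0 by rewrite nsq_eq0.
have hn := is_derive_inv n0 (is_derive_nsq h); have [f1 f2] := h.
(* Both parts of the quotient rule, as rational identities; the product type serves as a
   conjunction. *)
have fin : forall x y : R[i], x != 0 -> nsq x != 0 ->
    (Re (- y / x ^+ 2) = Re x * (- nsq x ^- 2 * (2 * Re (conjc x * y))) + (nsq x)^-1 * Re y) *
    (Im (- y / x ^+ 2) = - (Im x * (- nsq x ^- 2 * (2 * Re (conjc x * y))) + (nsq x)^-1 * Im y)).
  move=> x y x0 nx0; rewrite !ReM !ImM !ReV !ImV !ReN !ImN expr2 nsqM !ReM !ImM.
  case: x x0 nx0 => a b _; rewrite /nsq /= => nx0.
  by split; field.
have [e1 e2] := fin _ l F0 n0; split.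
  under eq_fun do rewrite ReV.
  by apply: (is_derive_eq (is_derive_mul f1 hn)).
under eq_fun do rewrite ImV mulNr.
by apply: (is_derive_eq (is_derive_opp (is_derive_mul f2 hn))).
Qed.

Lemma cdiff_exp F p v l : cdiff F p v l ->
  cdiff (fun q => cexp (F q)) p v (cexp (F p) * l).
Proof.
move=> [f1 f2].
have he := is_derive_comp (is_derive_expR (Re (F p))) f1.
have hc := is_derive_comp (is_derive_cos (Im (F p))) f2.
have hs := is_derive_comp (is_derive_sin (Im (F p))) f2.
split=> /=.
  apply: (is_derive_eq (is_derive_mul he hc)).
  rewrite ReM /= /GRing.scale /=; ring.
apply: (is_derive_eq (is_derive_mul he hs)).
rewrite ImM /= /GRing.scale /=; ring.
Qed.

Lemma is_derive_ln_nsq F p v l : F p != 0 -> cdiff F p v l ->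
  is_derive p v (fun q => ln (nsq (F q)) / 2) (Re (l / F p)).
Proof.
move=> F0 h; have n0 : 0 < nsq (F p) by rewrite nsq_gt0.
have hn := is_derive_nsq h.
have hl := is_derive_comp (is_derive1_ln n0) hn.
apply: (is_derive_eq (is_derive_mul hl (is_derive_cst (2^-1 : R) p v))).
rewrite !ReM ReV ImV /GRing.scale /=.
move: (lt0r_neq0 n0); case: (F p) => a b /=; rewrite /nsq /= => n1.
by field.
Qed.

(** The real part is [is_derive_ln_nsq]; on the right half-plane the argument is atan(Im / Re),
    whose derivative is the imaginary part of l / F. *)
Lemma cdiff_log F p v l : 0 < Re (F p) -> cdiff F p v l ->
  cdiff (fun q => clog (F q)) p v (l / F p).
Proof.
move=> r0 h; have r1 := lt0r_neq0 r0.
have F0 : F p != 0 by apply: contraTneq r0 => ->; rewrite ltxx.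
have := is_derive_ln_nsq F0 h => hl; split=> //=.
have [f1 f2] := h.
have := is_derive_mul f2 (is_derive_inv r1 f1) => hq.
apply: (is_derive_eq (is_derive_comp (is_derive1_atan _) hq)).
rewrite ImM ReV ImV /GRing.scale /=.
move: (F0); rewrite -nsq_eq0; move: r1; case: (F p) => a b /=; rewrite /nsq /= => a0 n1.
by field; rewrite a0 n1.
Qed.

Definition ccont F p :=
  (Re (F q) @[q --> p] --> Re (F p)) /\ (Im (F q) @[q --> p] --> Im (F p)).

Lemma ccont_cst (c : R[i]) p : ccont (fun=> c) p.
Proof. by split; apply: cvg_cst. Qed.

Lemma ccontD F G p : ccont F p -> ccont G p -> ccont (fun q => F q + G q) p.
Proof.
move=> [f1 f2] [g1 g2]; split; rewrite ?ReD ?ImD.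
  by under eq_fun do rewrite ReD; apply: cvgD.
by under eq_fun do rewrite ImD; apply: cvgD.
Qed.

Lemma ccontM F G p : ccont F p -> ccont G p -> ccont (fun q => F q * G q) p.
Proof.
move=> [f1 f2] [g1 g2]; split; rewrite ?ReM ?ImM.
  by under eq_fun do rewrite ReM; apply: cvgB; apply: cvgM.
by under eq_fun do rewrite ImM; apply: cvgD; apply: cvgM.
Qed.

Lemma ccontZ (c : R[i]) F p : ccont F p -> ccont (fun q => c * F q) p.
Proof. by move=> h; apply: ccontM => //; apply: ccont_cst. Qed.

Lemma ccont_sum (I : Type) (r : seq I) (F : I -> W -> R[i]) p :
  (forall i, ccont (F i) p) -> ccont (fun q => \sum_(i <- r) F i q) p.
Proof.
move=> h; elim: r => [|i r IH].
  under [X in ccont X]eq_fun do rewrite big_nil; exact: ccont_cst.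
under [X in ccont X]eq_fun do rewrite big_cons; exact: ccontD.
Qed.

Lemma ccont_prod (I : Type) (r : seq I) (F : I -> W -> R[i]) p :
  (forall i, ccont (F i) p) -> ccont (fun q => \prod_(i <- r) F i q) p.
Proof.
move=> h; elim: r => [|i r IH].
  under [X in ccont X]eq_fun do rewrite big_nil; exact: ccont_cst.
under [X in ccont X]eq_fun do rewrite big_cons; exact: ccontM.
Qed.

Lemma continuous_nsq F p : ccont F p -> nsq (F q) @[q --> p] --> nsq (F p).
Proof. by move=> [f1 f2]; apply: cvgD; rewrite !expr2; apply: cvgM. Qed.

Lemma ccontV F p : F p != 0 -> ccont F p -> ccont (fun q => (F q)^-1) p.
Proof.
move=> F0 h; have n0 : nsq (F p) != 0 by rewrite nsq_eq0.
have hn : (nsq (F q))^-1 @[q --> p] --> (nsq (F p))^-1.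
  by apply: cvgV => //; exact: continuous_nsq.
have [f1 f2] := h.
split; rewrite ?ReV ?ImV.
  by under eq_fun do rewrite ReV; apply: cvgM.
by under eq_fun do rewrite ImV; apply: cvgM => //; apply: cvgN.
Qed.

Lemma ccontXn F (k : nat) p : ccont F p -> ccont (fun q => F q ^+ k) p.
Proof.
move=> h; elim: k => [|k IH].
  under [X in ccont X]eq_fun do rewrite expr0; exact: ccont_cst.
under [X in ccont X]eq_fun do rewrite exprS; exact: ccontM.
Qed.

Lemma ccontXz F (k : int) p : F p != 0 -> ccont F p -> ccont (fun q => F q ^ k) p.
Proof.
move=> F0 h; case: k => k; first exact: ccontXn.
by apply: ccontV; [rewrite expf_neq0 | exact: ccontXn].
Qed.

Lemma ccont_exp F p : ccont F p -> ccont (fun q => cexp (F q)) p.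
Proof.
move=> [f1 f2]; split => /=; apply: cvgM.
- exact: (@continuous_cvg _ _ _ _ _ _ _ _ (@continuous_expR _ _) f1).
- exact: (@continuous_cvg _ _ _ _ _ _ _ _ (@continuous_cos _ _) f2).
- exact: (@continuous_cvg _ _ _ _ _ _ _ _ (@continuous_expR _ _) f1).
- exact: (@continuous_cvg _ _ _ _ _ _ _ _ (@continuous_sin _ _) f2).
Qed.

Lemma ccont_log F p : 0 < Re (F p) -> ccont F p -> ccont (fun q => clog (F q)) p.
Proof.
move=> r0 h; have r1 := lt0r_neq0 r0.
have F0 : F p != 0 by apply: contraTneq r0 => ->; rewrite ltxx.
have n0 : 0 < nsq (F p) by rewrite nsq_gt0.
split; rewrite /=.
  apply: cvgM; last exact: cvg_cst.
  exact: (@continuous_cvg _ _ _ _ _ _ _ _ (continuous_ln n0) (continuous_nsq h)).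
apply: (@continuous_cvg _ _ _ _ _ (fun q => Im (F q) / Re (F q)) (@atan R) _ (@continuous_atan _ _)).
by have [f1 f2] := h; apply: cvgM => //; apply: cvgV.
Qed.

End ComplexDerivative.

(** * Parallel coframes *)

Section TupleSums.
Variables (R : comNzRingType) (m : nat).

Lemma sum_tupleS k (F : k.+1.-tuple 'I_m -> R) :
  \sum_J F J = \sum_(a < m) \sum_(J : k.-tuple 'I_m) F [tuple of a :: J].
Proof.
rewrite pair_big /=.
rewrite (reindex (fun aJ : 'I_m * k.-tuple 'I_m => [tuple of aJ.1 :: aJ.2])) //=.
exists (fun J => (thead J, [tuple of behead J])) => [[a J] _|J _] /=.
  by congr pair; apply: val_inj.
by rewrite [RHS]tuple_eta.
Qed.

Lemma prod_sum_tuple k (F : 'I_k -> 'I_m -> R) :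
  \prod_(i < k) \sum_(a < m) F i a =
  \sum_(J : k.-tuple 'I_m) \prod_(i < k) F i (tnth J i).
Proof.
rewrite bigA_distr_bigA /=.
rewrite (reindex (fun J : k.-tuple 'I_m => [ffun i => tnth J i])) /=.
  by apply: eq_bigr => J _; apply: eq_bigr => i _; rewrite ffunE.
exists (fun f : {ffun 'I_k -> 'I_m} => [tuple f i | i < k]) => [J _|f _].
  by apply: eq_from_tnth => i; rewrite tnth_mktuple ffunE.
by apply/ffunP => i; rewrite ffunE tnth_mktuple.
Qed.

End TupleSums.

(* The coframe is the family of the columns of [E], the dual frame that of the
   rows of [Ei]. *)
Section ParallelCoframe.
Variables (R : realType) (m : nat).
Local Notation V := 'rV[R]_m.
Variables (U : set V) (g E Ei : V -> 'M[R]_m).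
Hypothesis openU : open U.
Hypothesis gE : forall p, U p -> g p = E p *m (E p)^T.
Hypothesis EEi : forall p, U p -> E p *m Ei p = 1%:M.
Hypothesis derE : forall p a b J, U p ->
  derivable (fun q => E q b J) p (delta_mx 0 a).
Hypothesis closedE : forall p a b J, U p ->
  pderiv a (fun q => E q b J) p = pderiv b (fun q => E q a J) p.

Lemma near_open p : U p -> \near p, U p.
Proof. by move=> Up; apply: open_nbhs_nbhs. Qed.

Lemma pderiv_eq_on_open (h k : V -> R) a p : U p -> (forall q, U q -> h q = k q) ->
  pderiv a h p = pderiv a k p.
Proof.
by move=> Up hk; apply: near_eq_derive; apply: filterS (near_open Up) => q /hk.
Qed.

Let EiE p : U p -> Ei p *m E p = 1%:M.
Proof. by move=> Up; apply: mulmx1C; rewrite EEi. Qed.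

Lemma invmx_coframe p : U p -> invmx (g p) = (Ei p)^T *m Ei p.
Proof.
move=> Up; have h : g p *m ((Ei p)^T *m Ei p) = 1%:M.
  rewrite gE // -mulmxA (mulmxA (E p)^T) -trmx_mul EiE // trmx1 mul1mx EEi //.
have [gu _] := mulmx1_unit h.
by rewrite -[RHS](mulKmx gu) h mulmx1.
Qed.

Lemma pderiv_metric p a b d : U p ->
  pderiv a (fun q => g q b d) p =
  \sum_J (pderiv a (fun q => E q b J) p * E p d J +
          E p b J * pderiv a (fun q => E q d J) p).
Proof.
move=> Up; rewrite (@pderiv_eq_on_open _ (fun q => \sum_J E q b J * E q d J)) //; last first.
  by move=> q Uq; rewrite gE // mxE; apply: eq_bigr => J _; rewrite mxE.
have d1 b' J := derivableP (@derE p a b' J Up).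
rewrite /pderiv; apply: derive_val; rewrite -fct_sumE.
apply: is_derive_sum => J; apply: (is_derive_eq (is_derive_mul (d1 b J) (d1 d J))).
by rewrite addrC mulrC.
Qed.

(** Each derivative of the metric splits in two by the product rule. By closedness of the coframe,
    four of the six terms cancel in pairs and the other two agree. *)
Lemma christoffel_coframe p c a b : U p ->
  christoffel g c a b p = \sum_J pderiv a (fun q => E q b J) p * Ei p J c.
Proof.
move=> Up; rewrite /christoffel.
transitivity (2^-1 * \sum_d invmx (g p) c d *
    (2 * \sum_J pderiv a (fun q => E q b J) p * E p d J)).
  congr (_ * _); apply: eq_bigr => d _; congr (_ * _).
  rewrite !pderiv_metric // -big_split -sumrB mulr_sumr; apply: eq_bigr => J _.
  by rewrite /= (@closedE p b a) // (@closedE p b d) // (@closedE p a d) //; ring.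
under eq_bigr do rewrite mulrCA.
rewrite -mulr_sumr mulrA mulVf ?pnatr_eq0 // mul1r.
under eq_bigr do rewrite mulr_sumr.
rewrite exchange_big; apply: eq_bigr => J _ /=.
under eq_bigr do rewrite mulrCA.
rewrite -mulr_sumr; congr (_ * _).
transitivity ((invmx (g p) *m E p) c J); first by rewrite mxE.
by rewrite invmx_coframe // -mulmxA EiE // mulmx1 mxE.
Qed.

(** This is parallelism: the forms of the coframe have zero covariant derivative. It is the previous
    formula multiplied by [E]. *)
Lemma pderiv_coframe p a b J : U p ->
  pderiv a (fun q => E q b J) p = \sum_c christoffel g c a b p * E p c J.
Proof.
move=> Up.
under eq_bigr do rewrite christoffel_coframe // mulr_suml.
rewrite exchange_big /=.
under eq_bigr => K _ do (under eq_bigr do rewrite -mulrA); rewrite -?mulr_sumr.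
transitivity (\sum_K pderiv a (fun q => E q b K) p * (Ei p *m E p) K J).
  by rewrite EiE // (bigD1 J) //= mxE eqxx mulr1 big1 ?addr0 // => K /negPf KJ; rewrite mxE KJ mulr0.
by apply: eq_bigr => K _; rewrite mxE mulr_sumr.
Qed.

(** The tensor with components [That] in the coframe [E], expressed in the coordinate frame. *)
Definition frame_tensor k (That : k.-tuple 'I_m -> V -> R) (s : k.-tuple 'I_m) p : R :=
  \sum_J (\prod_(i < k) E p (tnth s i) (tnth J i)) * That J p.

Lemma is_derive_prodr k (F : 'I_k -> V -> R) p v (d : 'I_k -> R) :
  (forall i, is_derive p v (F i) (d i)) ->
  is_derive p v (fun q => \prod_(i < k) F i q)
    (\sum_(j < k) \prod_(i < k) (if i == j then d i else F i p)).
Proof.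
elim: k F d => [|k IH] F d h.
  by rewrite big_ord0; under eq_fun do rewrite big_ord0; exact: is_derive_cst.
under eq_fun do rewrite big_ord_recl.
apply: (is_derive_eq (is_derive_mul (h ord0) (IH _ _ (fun i => h (lift ord0 i))))).
rewrite [RHS]big_ord_recl addrC big_ord_recl eqxx; congr (_ + _).
  by rewrite mulrC; congr (_ * _); apply: eq_bigr => i _.
rewrite mulr_sumr; apply: eq_bigr => j _; rewrite big_ord_recl /=; congr (_ * _).
Qed.

(** The coframe being parallel, the Christoffel terms cancel the derivatives of the coframe factors;
    what remains is the derivative of the components along the frame vectors. *)
Lemma covD_frame k (T : k.-tuple 'I_m -> V -> R) (That : k.-tuple 'I_m -> V -> R)
    (That' : k.+1.-tuple 'I_m -> V -> R) :
  (forall s p, U p -> T s p = frame_tensor That s p) ->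
  (forall J p a, U p -> derivable (That J) p (delta_mx 0 a)) ->
  (forall A (J : k.-tuple 'I_m) p, U p ->
     That' [tuple of A :: J] p = \sum_a Ei p A a * pderiv a (That J) p) ->
  forall s p, U p -> covD g T s p = frame_tensor That' s p.
Proof.
move=> TE dT T'E s p Up; rewrite /covD.
set a := thead s; set s' := [tuple of behead s].
rewrite (@pderiv_eq_on_open _ (frame_tensor That s')) //; last by move=> q /TE.
(* The term of the Leibniz rule in which the [j]-th factor is differentiated. *)
pose P j J := \prod_(i < k) (if i == j then pderiv a (fun q => E q (tnth s' i) (tnth J i)) p
                               else E p (tnth s' i) (tnth J i)).
have -> : pderiv a (frame_tensor That s') p =
    \sum_J (\sum_(j < k) P j J * That J p) +
    \sum_J (\prod_(i < k) E p (tnth s' i) (tnth J i)) * pderiv a (That J) p.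
  rewrite -big_split /=; apply: derive_val.
  have -> : frame_tensor That s' =
    \sum_(J : k.-tuple 'I_m) (fun q => (\prod_(i < k) E q (tnth s' i) (tnth J i)) * That J q).
    by apply/funext => q; rewrite /frame_tensor fct_sumE.
  have big : forall (I : finType) (h : I -> V -> R) (d : I -> R),
    (forall i, is_derive p (delta_mx 0 a : V) (h i) (d i)) ->
    is_derive p (delta_mx 0 a : V) (\sum_i h i) (\sum_i d i).
    move=> I h d hd; elim/big_ind2: _ => //; first exact: is_derive_cst.
    by move=> *; exact: is_deriveD.
  apply: big => J.
  have h1 := derivableP (dT J p a Up).
  have h2 := is_derive_prodr (fun i => derivableP (@derE p a (tnth s' i) (tnth J i) Up)).
  apply: (is_derive_eq (is_derive_mul h2 h1)).
  by rewrite addrC [That J p * _]mulrC mulr_suml.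
(* By [pderiv_coframe], the Christoffel correction of slot [j] is the Leibniz term of factor [j]. *)
have -> : \sum_(j < k) \sum_(c < m) christoffel g c a (tnth s' j) p *
      T [tuple (if i == j then c else tnth s' i) | i < k] p =
    \sum_J (\sum_(j < k) P j J * That J p).
  rewrite [RHS]exchange_big /=; apply: eq_bigr => j _.
  under eq_bigr do rewrite TE // mulr_sumr.
  rewrite exchange_big /=; apply: eq_bigr => J _.
  under eq_bigr do rewrite mulrA; rewrite -mulr_suml; congr (_ * _).
  rewrite /P (bigD1 j) //= eqxx pderiv_coframe // mulr_suml.
  apply: eq_bigr => c _; rewrite -[RHS]mulrA; congr (_ * _).
  rewrite (bigD1 j) //= tnth_mktuple eqxx; congr (_ * _).
  by apply: eq_bigr => i /negPf ij; rewrite tnth_mktuple ij.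
rewrite addrAC subrr add0r /frame_tensor sum_tupleS.
rewrite exchange_big /=; apply: eq_bigr => J _.
have sE i : tnth s (lift ord0 i) = tnth s' i by rewrite {1}(tuple_eta s) tnthS.
under [RHS]eq_bigr => A _.
  rewrite T'E // big_ord_recl tnth0 -/(thead s) -/a.
  under eq_bigr do rewrite sE tnthS.
  rewrite mulrAC mulr_sumr mulr_suml.
  over.
(* Summation over [A] contracts [E] with [Ei] to the identity, so that only the derivative along [a]
   survives. *)
rewrite /= [RHS]exchange_big /= (bigD1 a) //= [X in _ = _ + X]big1 ?addr0 => [|b /negPf ba].
  under [RHS]eq_bigr do rewrite mulrA -mulrA.
  rewrite -[LHS]mul1r -mulr_suml [\prod_(i < k) _ * _]mulrC; congr (_ * _).
  transitivity ((E p *m Ei p) a a); first by rewrite EEi // mxE eqxx.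
  by rewrite mxE.
under eq_bigr do rewrite mulrA -mulrA.
rewrite -mulr_suml; transitivity ((E p *m Ei p) a b * (pderiv b (That J) p * \prod_(i < k) E p (tnth s' i) (tnth J i))).
  by rewrite mxE.
by rewrite EEi // mxE eq_sym ba mul0r.
Qed.

(** The coframe is orthonormal: the inverse metric is a sum of squares of frame vectors, and it
    factors over the slots. *)
Lemma tensor_normsq_frame k (T That : k.-tuple 'I_m -> V -> R) p : U p ->
  (forall s, T s p = frame_tensor That s p) ->
  tensor_normsq g T p = \sum_J That J p ^+ 2.
Proof.
move=> Up TE; rewrite /tensor_normsq.
(* Evaluating the tensor on frame vectors recovers its components. *)
have key K : \sum_(s : k.-tuple 'I_m) (\prod_(j < k) Ei p (tnth K j) (tnth s j)) * T s p = That K p.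
  under eq_bigr do rewrite TE mulr_sumr.
  rewrite exchange_big /=.
  under eq_bigr => J _.
    under eq_bigr do rewrite mulrA -big_split /=.
    rewrite -mulr_suml -(prod_sum_tuple (fun i a => Ei p (tnth K i) a * E p a (tnth J i))).
    under eq_bigr => i _.
      rewrite (_ : \sum_(a < m) _ = (Ei p *m E p) (tnth K i) (tnth J i)); last by rewrite mxE.
      rewrite EiE // mxE; over.
    over.
  rewrite /= (bigD1 K) //= big1 ?mul1r => [|i _]; last by rewrite eqxx.
  rewrite big1 ?addr0 // => J JK.
  have [i Ji] : exists i, tnth K i != tnth J i.
    apply/existsP; apply: contraR JK => /existsPn h.
    by apply/eqP/eq_from_tnth => i; apply/esym/eqP; have := h i; rewrite negbK.
  by rewrite (bigD1 i) //= (negPf Ji) mul0r mul0r.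
transitivity (\sum_(s : k.-tuple 'I_m) \sum_(t : k.-tuple 'I_m) \sum_(K : k.-tuple 'I_m)
   ((\prod_(j < k) Ei p (tnth K j) (tnth s j)) * T s p) *
   ((\prod_(j < k) Ei p (tnth K j) (tnth t j)) * T t p)).
  apply: eq_bigr => s _; apply: eq_bigr => t _.
  have -> : \prod_(j < k) invmx (g p) (tnth s j) (tnth t j) =
     \sum_(K : k.-tuple 'I_m) \prod_(j < k) (Ei p (tnth K j) (tnth s j) * Ei p (tnth K j) (tnth t j)).
    rewrite -(prod_sum_tuple (fun j a => Ei p a (tnth s j) * Ei p a (tnth t j))).
    apply: eq_bigr => j _; rewrite invmx_coframe // mxE.
    by apply: eq_bigr => a _; rewrite mxE.
  rewrite !mulr_suml; apply: eq_bigr => K _; rewrite big_split /=; ring.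
under eq_bigr do rewrite exchange_big /=.
rewrite exchange_big /=; apply: eq_bigr => K _.
under eq_bigr do rewrite -mulr_sumr key.
by rewrite -mulr_suml key expr2.
Qed.

End ParallelCoframe.

(** * The flat torus *)

Section TorusCoordinates.
Variables (R : realType) (n : nat).
Local Notation V := 'rV[R]_(n + n).
Local Notation Cn := ('I_n -> R[i]).
Local Notation e a := (delta_mx 0 a : V).
Implicit Types (p q v : V) (w m : Cn) (J a b c : 'I_(n + n)).

(* The [J]-th of the real coordinates (x_1, ..., x_n, y_1, ..., y_n) of [w]. *)
Definition cpt J w : R :=
  match fintype.split J with inl j => Re (w j) | inr j => Im (w j) end.

Lemma cpt_lshift j w : cpt (lshift n j) w = Re (w j).
Proof. by rewrite /cpt -[lshift n j]/(unsplit (inl j)) unsplitK. Qed.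

Lemma cpt_rshift j w : cpt (rshift n j) w = Im (w j).
Proof. by rewrite /cpt -[rshift n j]/(unsplit (inr j)) unsplitK. Qed.

Lemma cptD J w w' : cpt J (fun j => w j + w' j) = cpt J w + cpt J w'.
Proof. by rewrite /cpt; case: fintype.split => j; rewrite ?ReD ?ImD. Qed.

Lemma cptZ J (r : R) w : cpt J (fun j => r%:C%C * w j) = r * cpt J w.
Proof.
by rewrite /cpt; case: fintype.split => j; rewrite ?ReM ?ImM /= mul0r ?subr0 ?addr0.
Qed.

Lemma cpt0 J : cpt J (fun=> 0) = 0.
Proof. by rewrite /cpt; case: fintype.split. Qed.

Lemma cpt_sum (I : Type) (r : seq I) (F : I -> Cn) J :
  cpt J (fun j => \sum_(i <- r) F i j) = \sum_(i <- r) cpt J (F i).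
Proof.
elim: r => [|i r IH].
  by rewrite big_nil -[RHS](cpt0 J); congr cpt; apply/funext => j; rewrite big_nil.
by rewrite big_cons -IH -cptD; congr cpt; apply/funext => j; rewrite big_cons.
Qed.

Lemma sum_cptM w w' :
  \sum_J cpt J w * cpt J w' = \sum_(j < n) (Re (w j) * Re (w' j) + Im (w j) * Im (w' j)).
Proof.
rewrite big_split_ord /= -big_split /=; apply: eq_bigr => j _.
by rewrite !cpt_lshift !cpt_rshift.
Qed.

Definition vec w : V := \row_J cpt J w.

Lemma zcoord_vec w j : zcoord j (vec w) = w j.
Proof. by apply: complex_ext; rewrite /= mxE ?cpt_lshift ?cpt_rshift. Qed.

Lemma vec_zcoord p : vec (fun j => zcoord j p) = p.
Proof.
apply/rowP => J; rewrite mxE /cpt; case: fintype.splitP => j Jj /=.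
  by congr (p 0 _); apply: val_inj.
by congr (p 0 _); apply: val_inj.
Qed.

Lemma vec_inj p q : (forall j, zcoord j p = zcoord j q) -> p = q.
Proof. by move=> h; rewrite -(vec_zcoord p) -(vec_zcoord q); congr vec; apply/funext. Qed.

Lemma zcoordD p q j : zcoord j (p + q) = zcoord j p + zcoord j q.
Proof. by apply: complex_ext; rewrite /= !mxE. Qed.

Lemma zcoordZ (r : R) p j : zcoord j (r *: p) = r%:C%C * zcoord j p.
Proof. by apply: complex_ext; rewrite ?ReM ?ImM /= !mxE mul0r ?subr0 ?addr0. Qed.

Lemma zcoord0 j : zcoord j (0 : V) = 0.
Proof. by apply: complex_ext; rewrite /= mxE. Qed.

Lemma zcoord_sum_delta v j :
  zcoord j v = \sum_a (v 0 a)%:C%C * zcoord j (e a).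
Proof.
rewrite {1}(row_sum_delta v) (big_morph _ (fun p q => zcoordD p q j) (zcoord0 j)).
by apply: eq_bigr => a _; rewrite zcoordZ.
Qed.

Lemma zcoord_lshift (j k : 'I_n) : zcoord j (e (lshift n k)) = (j == k)%:R.
Proof.
apply: complex_ext; rewrite /= !mxE eqxx /=.
  by rewrite (inj_eq (@lshift_inj _ _)); case: eqP.
by rewrite eq_rlshift; case: eqP.
Qed.

Lemma zcoord_rshift (j k : 'I_n) : zcoord j (e (rshift n k)) = 'i%C *+ (j == k).
Proof.
apply: complex_ext; rewrite /= !mxE eqxx /=.
  by rewrite eq_lrshift; case: eqP.
by rewrite (inj_eq (@rshift_inj _ _)); case: eqP.
Qed.

(* The real matrix, acting on row vectors, of the C-linear map diag(m) on C^n. *)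
Definition diagC m : 'M[R]_(n + n) :=
  \matrix_(a, J) cpt J (fun j => zcoord j (e a) * m j).

Lemma mul_diagC v m : v *m diagC m = vec (fun j => zcoord j v * m j).
Proof.
apply/rowP => J; rewrite !mxE.
under eq_bigr do rewrite mxE -cptZ.
rewrite -cpt_sum; congr cpt; apply/funext => j.
by rewrite zcoord_sum_delta mulr_suml; apply: eq_bigr => a _; rewrite mulrA.
Qed.

Lemma diagC_inv m : (forall j, m j != 0) ->
  diagC (fun j => (m j)^-1) *m diagC m = 1%:M.
Proof.
move=> m0; apply/row_matrixP => a; rewrite row_mul rowE mul_diagC mul_diagC row1.
by apply: vec_inj => j; rewrite !zcoord_vec mulfVK.
Qed.

Definition coframe p := diagC (fun j => (zcoord j p)^-1).
Definition frame p := diagC (fun j => zcoord j p).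

Lemma coframeK p : torus p -> coframe p *m frame p = 1%:M.
Proof. by move=> tp; apply: diagC_inv. Qed.

Lemma torus_metricE p : torus_metric p = coframe p *m (coframe p)^T.
Proof.
apply/matrixP => a b; rewrite !mxE.
under [RHS]eq_bigr do rewrite !mxE.
cbv zeta; rewrite sum_cptM mulr_sumr Re_sum; apply: eq_bigr => j _.
exact: Re_polarization.
Qed.

Lemma gnorm_torus p v :
  gnorm (@torus_metric R n) p v = Num.sqrt (\sum_(j < n) nsq (zcoord j v / zcoord j p)).
Proof.
rewrite /gnorm torus_metricE mulmxA -mulmxA -trmx_mul mul_diagC mxE; congr Num.sqrt.
under eq_bigr do rewrite !mxE.
by rewrite sum_cptM; apply: eq_bigr => j _; rewrite /nsq !expr2.
Qed.

Lemma is_derive_coord p v J : is_derive p v (fun q => q 0 J) (v 0 J).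
Proof.
apply/is_derive_line.
have := is_derive_add (is_derive_mul (is_derive_id (0 : R) 1) (is_derive_cst (v 0 J) (0 : R) 1))
   (is_derive_cst (p 0 J) (0 : R) 1).
move=> h; have -> : (fun t : R => (t *: v + p) 0 J) =
    (fun q : R => q * cst (v 0 J) q + cst (p 0 J) q) by apply/funext => t; rewrite !mxE.
by apply: (is_derive_eq h); rewrite mulr0 add0r addr0 mulr1.
Qed.

Lemma cdiff_zcoord j p v : cdiff (zcoord j) p v (zcoord j v).
Proof. by split; exact: is_derive_coord. Qed.

Lemma ccont_zcoord j p : ccont (zcoord j) p.
Proof. by split; exact: coord_continuous. Qed.

Lemma is_derive_cpt (W : normedModType R) (F : W -> Cn) (p v : W) w J :
  (forall j, cdiff (F^~ j) p v (w j)) ->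
  is_derive p v (fun q : W => cpt J (F q)) (cpt J w).
Proof. by move=> h; rewrite /cpt; case: fintype.split => j; have [] := h j. Qed.

Lemma open_nonzero (A : set V) (F : 'I_n -> V -> R[i]) : open A ->
  (forall j q, A q -> ccont (F j) q) ->
  open [set q | A q /\ forall j, F j q != 0].
Proof.
move=> oA cF; rewrite openE => q [Aq Fq]; rewrite /interior /=.
apply: filterI; first exact: open_nbhs_nbhs.
apply: (@filter_forall V 'I_n (fun j x => F j x != 0) (nbhs q)) => j.
have h := continuous_nsq (cF j q Aq).
have : 0 < nsq (F j q) by rewrite nsq_gt0.
move/(cvgr_gt _ h); apply: filterS => x; exact: (fun h => etrans (esym (nsq_gt0 _)) h).
Qed.

Lemma open_torus : open (@torus R n).
Proof.
rewrite (_ : @torus R n = [set q | setT q /\ forall j, zcoord j q != 0]).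
  by apply: (@open_nonzero setT) => [|j q _]; [exact: openT|exact: ccont_zcoord].
by apply/seteqP; split => q /=; [split|case].
Qed.

Lemma is_derive_coframe p v a J : torus p ->
  is_derive p v (fun q => coframe q a J)
    (cpt J (fun j => - (zcoord j v * zcoord j (e a)) / zcoord j p ^+ 2)).
Proof.
move=> tp; under [X in is_derive _ _ X]eq_fun do rewrite mxE.
apply: is_derive_cpt => j.
apply: cdiff_eq (cdiffZ _ (cdiffV (tp j) (cdiff_zcoord j p v))) _.
by rewrite mulrA mulrN (mulrC (zcoord j (e a))).
Qed.

Lemma derivable_coframe p a b J : torus p ->
  derivable (fun q => coframe q b J) p (e a).
Proof. by move=> tp; case: (is_derive_coframe (e a) b J tp). Qed.

Lemma closed_coframe p a b J : torus p ->
  pderiv a (fun q => coframe q b J) p = pderiv b (fun q => coframe q a J) p.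
Proof.
move=> tp; rewrite /pderiv (is_derive_val (is_derive_coframe (e a) b J tp)).
rewrite (is_derive_val (is_derive_coframe (e b) a J tp)).
by congr cpt; apply/funext => j; rewrite (mulrC (zcoord j (e a))).
Qed.

Local Notation g := (@torus_metric R n).

(** In the complex coordinate z_j the connection has the single symbol -1/z_j: it sends tangent
    vectors v, w to -v_j w_j / z_j. *)
Lemma christoffel_torus p c a b : torus p ->
  christoffel g c a b p =
  cpt c (fun j => - (zcoord j (e a) * zcoord j (e b)) * (zcoord j p)^-1).
Proof.
move=> tp.
rewrite (@christoffel_coframe _ _ (@torus R n) g coframe frame open_torus (fun p _ => torus_metricE p)
   coframeK derivable_coframe closed_coframe) //.
pose w j := - (zcoord j (e a) * zcoord j (e b)) / zcoord j p ^+ 2.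
transitivity ((vec w *m frame p) 0 c).
  rewrite mxE; apply: eq_bigr => J _; congr (_ * _).
  by rewrite mxE /pderiv (is_derive_val (is_derive_coframe (e a) b J tp)).
rewrite mul_diagC mxE; congr cpt; apply/funext => j; rewrite zcoord_vec /w.
by rewrite expr2 invfM mulrA mulfVK.
Qed.

(** The derivative of a Christoffel symbol and the quadratic sum are both equal to [K a b], which is
    symmetric in [a] and [b]; the antisymmetrization therefore vanishes. *)
Lemma curvature_torus p d c a b : torus p -> curvature g d c a b p = 0.
Proof.
move=> tp; rewrite /curvature.
pose K a b := cpt d (fun j => zcoord j (e a) * zcoord j (e b) * zcoord j (e c) / zcoord j p ^+ 2).
have dK a' b' : pderiv a' (christoffel g d b' c) p = K a' b'.
  rewrite (pderiv_eq_on_open open_torus a' tp (fun q tq => christoffel_torus d b' c tq)).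
  apply: derive_val; apply: (@is_derive_cpt _ (fun q j => _)) => j.
  apply: cdiff_eq (cdiffZ _ (cdiffV (tp j) (cdiff_zcoord j p _))) _.
  by rewrite mulrA mulrNN; congr (_ / _); ring.
have sK a' b' : \sum_k christoffel g d a' k p * christoffel g k b' c p = K a' b'.
  pose w j := - (zcoord j (e b') * zcoord j (e c)) * (zcoord j p)^-1.
  transitivity ((vec w *m diagC (fun j => - zcoord j (e a') * (zcoord j p)^-1)) 0 d).
    rewrite mxE; apply: eq_bigr => k _; rewrite !christoffel_torus // !mxE mulrC.
    by congr (_ * cpt _ _); apply/funext => j; rewrite -mulNr mulrA mulrN (mulrC (zcoord j (e k))) mulNr.
  rewrite mul_diagC mxE; congr cpt; apply/funext => j; rewrite zcoord_vec /w.
  by rewrite mulrACA mulrNN -invfM -expr2; congr (_ / _); ring.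
have KC : K b a = K a b; last by rewrite !dK sumrB /= !sK KC !subrr addr0.
by congr cpt; apply/funext => j; rewrite (mulrC (zcoord j (e b))).
Qed.

End TorusCoordinates.

Section ZeroTensor.
Variables (R : realType) (m : nat).
Local Notation V := 'rV[R]_m.
Variables (U : set V) (g : V -> 'M[R]_m).
Hypothesis openU : open U.

(** As [U] is open, functions that vanish on it have zero partial derivatives at its points. *)
Lemma iter_covD_eq0 l k (T : k.-tuple 'I_m -> V -> R) :
  (forall s p, U p -> T s p = 0) ->
  forall s p, U p -> @iter_covD R m g l k T s p = 0.
Proof.
move=> T0; elim: l => [|l IH] //= s p Up; rewrite /covD.
rewrite (pderiv_eq_on_open openU (k := cst 0)) //; last by move=> q Uq; exact: IH.
rewrite /pderiv derive_cst sub0r big1 ?oppr0 // => j _.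
by rewrite big1 // => c _; rewrite IH // mulr0.
Qed.

Lemma tensor_norm_eq0 k (T : k.-tuple 'I_m -> V -> R) p :
  (forall s, T s p = 0) -> tensor_norm g T p = 0.
Proof.
move=> T0; rewrite /tensor_norm /tensor_normsq big1 ?sqrtr0 // => s _.
by rewrite big1 // => t _; rewrite !T0 mulr0.
Qed.

End ZeroTensor.

(** * Covariant derivatives of Laurent polynomials *)

Section LogarithmicDerivative.
Variables (R : realType) (W : normedModType R).
Implicit Types (F G : W -> R[i]) (p v : W) (l : R[i]).

(* [l] is the derivative of [log F] along [v]. *)
Definition logdiff F p v l := F p != 0 /\ cdiff F p v (F p * l).

Lemma logdiffM F G p v l l' : logdiff F p v l -> logdiff G p v l' ->
  logdiff (fun q => F q * G q) p v (l + l').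
Proof.
move=> [F0 f] [G0 h]; split; first by rewrite mulf_neq0.
by apply: cdiff_eq (cdiffM f h) _; ring.
Qed.

Lemma logdiff1 p v : logdiff (fun=> 1) p v 0.
Proof. by split; rewrite ?oner_eq0 // mulr0; exact: cdiff_cst. Qed.

Lemma logdiffXz F (k : int) p v l : logdiff F p v l ->
  logdiff (fun q => F q ^ k) p v (k%:~R * l).
Proof.
move=> h.
have X (j : nat) : logdiff (fun q => F q ^+ j) p v (j%:R * l).
  elim: j => [|j IH].
    by rewrite mul0r; under [X in logdiff X]eq_fun do rewrite expr0; exact: logdiff1.
  under [X in logdiff X]eq_fun do rewrite exprS.
  by rewrite -natr1 addrC mulrDl mul1r; exact: logdiffM.
case: k => j; first exact: X.
have [F0 f] := X j.+1; split; first by rewrite invr_neq0.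
apply: cdiff_eq (cdiffV F0 f) _.
have -> : F p ^ Negz j = (F p ^+ j.+1)^-1 by [].
by rewrite NegzE mulrNz; field.
Qed.

Lemma logdiff_prod (I : Type) (r : seq I) (F : I -> W -> R[i]) p v (l : I -> R[i]) :
  (forall i, logdiff (F i) p v (l i)) ->
  logdiff (fun q => \prod_(i <- r) F i q) p v (\sum_(i <- r) l i).
Proof.
move=> h; elim: r => [|i r IH].
  rewrite big_nil; under [X in logdiff X]eq_fun do rewrite big_nil.
  exact: logdiff1.
rewrite big_cons; under [X in logdiff X]eq_fun do rewrite big_cons.
exact: logdiffM.
Qed.

End LogarithmicDerivative.

Section LaurentDerivatives.
Variables (R : realType) (n : nat).
Local Notation V := 'rV[R]_(n + n).
Local Notation e a := (delta_mx 0 a : V).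
Local Notation g := (@torus_metric R n).
Implicit Types (p q v : V) (c : laurent R n) (alpha : 'rV[int]_n).

Definition monomial alpha p : R[i] := \prod_(j < n) zcoord j p ^ alpha 0 j.

Lemma cdiff_monomial alpha p v : torus p ->
  cdiff (monomial alpha) p v
    (monomial alpha p * \sum_(j < n) (alpha 0 j)%:~R * (zcoord j v / zcoord j p)).
Proof.
move=> tp; apply: (proj2 (logdiff_prod _ _)) => j; apply: logdiffXz.
by split=> //; rewrite mulrC divfK //; exact: cdiff_zcoord.
Qed.

(* The eigenvalue on [z^alpha] of the derivation along the frame vector [a],
   i.e. alpha_j or i alpha_j. *)
Definition frame_weight alpha (a : 'I_(n + n)) : R[i] :=
  \sum_(j < n) (alpha 0 j)%:~R * zcoord j (e a).

Definition frame_deriv c (J : seq 'I_(n + n)) p : R[i] :=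
  \sum_(alpha <- finsupp c)
    c alpha * \prod_(a <- J) frame_weight alpha a * monomial alpha p.

Lemma cdiff_frame_deriv c J p v : torus p ->
  cdiff (frame_deriv c J) p v
    (\sum_(j < n) (\sum_(alpha <- finsupp c) c alpha * \prod_(a <- J) frame_weight alpha a
        * monomial alpha p * (alpha 0 j)%:~R / zcoord j p) * zcoord j v).
Proof.
move=> tp; apply: cdiff_eq (cdiff_sum _ (fun alpha => cdiffZ _ (cdiff_monomial alpha v tp))) _.
under [RHS]eq_bigr do rewrite mulr_suml.
rewrite [RHS]exchange_big /=; apply: eq_bigr => alpha _.
by rewrite !mulr_sumr; apply: eq_bigr => j _; ring.
Qed.

(** The [a]-th frame vector has complex coordinates [zcoord j (e a) * zcoord j p]; its factor z_j
    cancels the denominator, and one more weight comes down. *)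
Lemma frame_deriv_frame c J p (a : 'I_(n + n)) : torus p ->
  \sum_(j < n) (\sum_(alpha <- finsupp c) c alpha * \prod_(a <- J) frame_weight alpha a
        * monomial alpha p * (alpha 0 j)%:~R / zcoord j p) * (zcoord j (e a) * zcoord j p)
  = frame_deriv c (a :: J) p.
Proof.
move=> tp; under eq_bigr do rewrite mulr_suml.
rewrite exchange_big /=; apply: eq_bigr => alpha _.
rewrite big_cons /frame_weight mulr_suml mulr_sumr mulr_suml; apply: eq_bigr => j _.
by field; rewrite tp.
Qed.

(** Stated for an R-linear [P] that commutes with differentiation, in order to treat the real and
    imaginary parts at once. *)
Lemma iter_covD_laurent c (P : R[i] -> R) :
  (forall x y, P (x + y) = P x + P y) -> (forall (r : R) x, P (r%:C%C * x) = r * P x) ->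
  (forall (F : V -> R[i]) p v l, cdiff F p v l -> is_derive p v (fun q => P (F q)) (P l)) ->
  forall k s p, torus p ->
  @iter_covD R _ g k 0 (scalar_tensor (fun q => P (laurent_eval c q))) s p =
  frame_tensor (@coframe R n) (fun J q => P (frame_deriv c J q)) s p.
Proof.
move=> PD PZ Pd; elim=> [|k IH] s p tp.
  rewrite /= /frame_tensor (big_pred1 [tuple]) => [|J]; last first.
    by case: J => [[|//] ?]; apply/esym/eqP/val_inj.
  rewrite big_ord0 mul1r /scalar_tensor; congr P; apply: eq_bigr => alpha _.
  by rewrite big_nil mulr1.
apply: (@covD_frame _ _ (@torus R n) g (@coframe R n) (@frame R n) (@open_torus R n)
   (fun p _ => torus_metricE p) (@coframeK R n) (@derivable_coframe R n) (@closed_coframe R n)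
   _ _ _ _ IH) => // [J q a tq|a J q tq].
  by case: (Pd _ _ _ _ (cdiff_frame_deriv c J (e a) tq)).
rewrite /= -frame_deriv_frame //.
have PS (I : Type) (r : seq I) (F : I -> R[i]) : P (\sum_(i <- r) F i) = \sum_(i <- r) P (F i).
  by apply: (big_morph P PD); have := PZ 0 0; rewrite mulr0 mul0r.
under [RHS]eq_bigr do rewrite /pderiv (is_derive_val (Pd _ _ _ _ (cdiff_frame_deriv c J (e _) tq))) -PZ mulr_sumr.
rewrite -PS exchange_big /=; congr P; apply: eq_bigr => j _.
under [RHS]eq_bigr do rewrite mulrCA.
rewrite -mulr_sumr; congr (_ * _).
rewrite -(zcoord_vec (fun j => zcoord j (e a) * zcoord j q)) -mul_diagC -rowE.
by rewrite zcoord_sum_delta; apply: eq_bigr => b _; rewrite mxE.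
Qed.

Lemma nabla_norm_laurent c k p : torus p ->
  nabla_norm g k (laurent_eval c) p =
  Num.sqrt (\sum_(J : (k + 0).-tuple 'I_(n + n)) nsq (frame_deriv c J p)).
Proof.
move=> tp; rewrite /nabla_norm.
have N P : (forall x y, P (x + y) = P x + P y) -> (forall (r : R) x, P (r%:C%C * x) = r * P x) ->
    (forall (F : V -> R[i]) p v l, cdiff F p v l -> is_derive p v (fun q => P (F q)) (P l)) ->
    tensor_normsq g (@iter_covD R _ g k 0 (scalar_tensor (fun q => P (laurent_eval c q)))) p =
    \sum_(J : (k + 0).-tuple 'I_(n + n)) P (frame_deriv c J p) ^+ 2.
  move=> PD PZ Pd.
  exact: (@tensor_normsq_frame R _ (@torus R n) g (@coframe R n) (@frame R n)
    (fun p _ => torus_metricE p) (@coframeK R n) (k + 0) _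
    (fun J q => P (frame_deriv c J q)) p tp (fun s => iter_covD_laurent c PD PZ Pd s tp)).
have ReZ (r : R) (x : R[i]) : Re (r%:C%C * x) = r * Re x by rewrite ReM /= mul0r subr0.
have ImZ (r : R) (x : R[i]) : Im (r%:C%C * x) = r * Im x by rewrite ImM /= mul0r addr0.
rewrite (N _ (@ReD R) ReZ (fun F q v l h => proj1 h)).
rewrite (N _ (@ImD R) ImZ (fun F q v l h => proj2 h)).
by rewrite -big_split.
Qed.

(** Translates the Wirtinger derivatives of the non-degeneracy condition into derivatives along the
    frame. *)
Lemma zcoord_dz c j p : torus p ->
  zcoord j p * dz j (laurent_eval c) p = frame_deriv c [:: lshift n j] p.
Proof.
move=> tp.
have fE : laurent_eval c = frame_deriv c [::].
  by apply/funext => q; apply: eq_bigr => alpha _; rewrite big_nil mulr1.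
rewrite /dz fE.
have dE a : Complex (pderiv a (fun q => Re (frame_deriv c [::] q)) p)
                  (pderiv a (fun q => Im (frame_deriv c [::] q)) p) =
   \sum_(k < n) (\sum_(alpha <- finsupp c) c alpha * \prod_(a <- [::]) frame_weight alpha a
        * monomial alpha p * (alpha 0 k)%:~R / zcoord k p) * zcoord k (e a).
  have [h1 h2] := cdiff_frame_deriv c [::] (e a) tp.
  by apply: complex_ext; rewrite /= /pderiv ?(is_derive_val h1) ?(is_derive_val h2).
pose S := \sum_(alpha <- finsupp c) c alpha * \prod_(a <- [::]) frame_weight alpha a
        * monomial alpha p * (alpha 0 j)%:~R / zcoord j p.
have sum_j (w : 'I_n -> R[i]) (F : 'I_n -> R[i]) : (forall k, k != j -> w k = 0) ->
    \sum_(k < n) F k * w k = F j * w j.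
  by move=> w0; rewrite (bigD1 j) //= big1 ?addr0 // => k kj; rewrite w0 ?mulr0.
(* The derivative along y_j is i times the one along x_j (Cauchy-Riemann), so that the two halves of
   the Wirtinger derivative agree. *)
transitivity (zcoord j p * (2^-1 * (S - 'i%C * (S * 'i%C)))).
  congr (_ * (_ * (_ - _ * _))).
    rewrite dE sum_j ?zcoord_lshift ?eqxx ?mulr1 // => k /negPf kj.
    by rewrite zcoord_lshift kj.
  rewrite dE sum_j ?zcoord_rshift ?eqxx ?mulr1n // => k /negPf kj.
  by rewrite zcoord_rshift kj.
rewrite -frame_deriv_frame // sum_j; last first.
  by move=> k /negPf kj; rewrite zcoord_lshift kj mul0r.
have -> : S - 'i%C * (S * 'i%C) = 2 * S.
  by rewrite mulrCA -expr2 sqr_i mulrN1 opprK mulr_natl mulr2n.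
rewrite zcoord_lshift eqxx mul1r -/S.
by rewrite mulKf ?pnatr_eq0 // mulrC.
Qed.

End LaurentDerivatives.

(** * Distance and completeness *)

Section Curves.
Variables (R : realType) (n : nat).
Local Notation V := 'rV[R]_(n + n).
Local Notation Cn := ('I_n -> R[i]).
Local Notation g := (@torus_metric R n).
Local Notation U := (@torus R n).
Implicit Types (p q v : V) (w c : Cn) (gamma : R -> V) (j : 'I_n).

Definition logmod j p : R := ln (nsq (zcoord j p)) / 2.

Lemma derivable_vec (F : R -> Cn) t w : (forall j, cdiff (F^~ j) t 1 (w j)) ->
  derivable (fun s => vec (F s)) t 1 /\ derive1 (fun s => vec (F s)) t = vec w.
Proof.
move=> h.
have hJ J : is_derive t 1 (fun s => vec (F s) 0 J) (cpt J w).
  by under eq_fun do rewrite mxE; exact: is_derive_cpt.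
have d : derivable (fun s => vec (F s)) t 1.
  by apply/derivable_mxP => i J; rewrite ord1; case: (hJ J).
split=> //; rewrite derive1E derive_mx //; apply/rowP => J.
by rewrite !mxE (is_derive_val (hJ J)).
Qed.

Lemma cdiff_curve gamma t j : derivable gamma t 1 ->
  cdiff (fun s => zcoord j (gamma s)) t 1 (zcoord j (derive1 gamma t)).
Proof.
move=> d; have dJ J := derivableP ((derivable_mxP gamma t 1).1 d 0 J).
by rewrite derive1E derive_mx //; split => /=; rewrite mxE; exact: dJ.
Qed.

Lemma ccont_zcoord_comp (T : normedModType R) (h : T -> V) (t : T) j :
  {for t, continuous h} -> ccont (fun s => zcoord j (h s)) t.
Proof.
by move=> ch; split; apply: (@continuous_cvg _ _ _ _ _ h (fun q : V => q 0 _)) => //;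
  exact: coord_continuous.
Qed.

Lemma cvg_sum_nsq (I : finType) (T : normedModType R) (F : I -> T -> R[i]) t :
  (forall i, ccont (F i) t) ->
  \sum_i nsq (F i s) @[s --> t] --> \sum_i nsq (F i t).
Proof.
move=> cF; elim: (index_enum _) => [|j r IH].
  by rewrite big_nil; under eq_fun do rewrite big_nil; exact: cvg_cst.
rewrite big_cons; under eq_fun do rewrite big_cons.
by apply: cvgD => //; exact: continuous_nsq.
Qed.

(** The straight line of direction [w] in logarithmic coordinates, starting at [c]. *)
Definition expcurve c w (t : R) : V := vec (fun j => c j * cexp (t%:C%C * w j)).

Lemma derivable_expcurve c w t :
  derivable (expcurve c w) t 1 /\
  derive1 (expcurve c w) t = expcurve (fun j => w j * c j) w t.
Proof.
apply: derivable_vec => j.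
have dt : cdiff (fun s : R => s%:C%C) t 1 1.
  by split=> /=; [exact: is_derive_id | exact: is_derive_cst].
apply: cdiff_eq (cdiffZ (c j) (cdiff_exp (cdiffM dt (cdiff_cst (w j) t 1)))) _.
by rewrite mul1r mulr0 addr0; ring.
Qed.

Lemma derive1_expcurve c w : derive1 (expcurve c w) = expcurve (fun j => w j * c j) w.
Proof. by apply/funext => t; have [] := derivable_expcurve c w t. Qed.

Lemma expcurve0 c w : expcurve c w 0 = vec c.
Proof. by apply: vec_inj => j; rewrite !zcoord_vec mul0r cexp0 mulr1. Qed.

Lemma torus_expcurve c w t : (forall j, c j != 0) -> U (expcurve c w t).
Proof. by move=> c0 j; rewrite zcoord_vec mulf_neq0 ?cexp_neq0. Qed.

Lemma expcurve_C1 c w : (forall j, c j != 0) -> C1_curve U (expcurve c w).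
Proof.
move=> c0; split=> [t| |t _]; [by case: (derivable_expcurve c w t)| |exact: torus_expcurve].
rewrite derive1_expcurve => t; apply/differentiable_continuous/derivable1_diffP.
by case: (derivable_expcurve (fun j => w j * c j) w t).
Qed.

(** The logarithmic velocity is the constant [w], so the speed is constant too. *)
Lemma curve_length_expcurve c w : (forall j, c j != 0) ->
  curve_length g (expcurve c w) = (Num.sqrt (\sum_(j < n) nsq (w j)))%:E.
Proof.
move=> c0; rewrite /curve_length.
transitivity (\int[lebesgue_measure]_(t in `[0%R, 1%R])
    (cst (Num.sqrt (\sum_(j < n) nsq (w j)))%:E t : \bar R))%E.
  apply: eq_integral => t _ /=; congr (_%:E); rewrite derive1_expcurve gnorm_torus.
  congr Num.sqrt; apply: eq_bigr => j _; congr nsq; rewrite !zcoord_vec -[w j * c j * _]mulrA mulfK //.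
  by rewrite mulf_neq0 ?cexp_neq0.
rewrite integral_cst //= lebesgue_measure_itv /= lte_fin ltr01.
by rewrite -EFinB subr0 mule1.
Qed.

Lemma dist_le_exp p q w : U p -> (forall j, zcoord j q = zcoord j p * cexp (w j)) ->
  (dist U g p q <= (Num.sqrt (\sum_(j < n) nsq (w j)))%:E)%E.
Proof.
move=> Up qE; pose c j := zcoord j p.
have q1 : expcurve c w 1 = q.
  by apply: vec_inj => j; rewrite zcoord_vec mul1r qE.
have Uq : U q by rewrite -q1; exact: torus_expcurve.
apply: ereal_inf_lbound => /=.
rewrite -(curve_length_expcurve w Up) -[curve_length _ _]adde0.
have {1}-> : p = expcurve c w 0 by rewrite expcurve0 vec_zcoord.
by apply: joined_cons; [exact: expcurve_C1 | rewrite q1; exact: joined_refl].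
Qed.

Lemma joined_trans p q r l l' : joined U g p q l -> joined U g q r l' ->
  joined U g p r (l + l')%E.
Proof.
elim=> [x Ux|gamma x k C _ IH] h; first by rewrite add0e.
by rewrite -addeA; apply: joined_cons => //; exact: IH.
Qed.

Lemma dist_trans_lt p q r (a b : R) : (dist U g p q < a%:E)%E ->
  (dist U g q r < b%:E)%E -> (dist U g p r < (a + b)%:E)%E.
Proof.
move=> /ereal_inf_lt [l /= pq la] /ereal_inf_lt [l' /= qr lb].
apply: (@le_lt_trans _ _ (l + l')%E); last by rewrite EFinD lteD.
by apply: ereal_inf_lbound; exact: joined_trans qr.
Qed.

Lemma Re_dlog_le_gnorm p v j : U p ->
  `|Re (zcoord j v / zcoord j p)| <= gnorm g p v.
Proof.
move=> Up; rewrite gnorm_torus -sqrtr_sqr ler_sqrt; last first.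
  by apply: sumr_ge0 => k _; exact: nsq_ge0.
rewrite (bigD1 j) //= -[leLHS]addr0 lerD ?sumr_ge0 // => [|k _]; last exact: nsq_ge0.
by rewrite /nsq lerDl sqr_ge0.
Qed.

(** Along the curve, the derivative of log|z_j| is the real part of dz_j / z_j on the velocity,
    which the speed dominates; then integrate. *)
Lemma curve_length_ge gamma j : C1_curve U gamma ->
  ((`|logmod j (gamma 1) - logmod j (gamma 0)|)%:E <= curve_length g gamma)%E.
Proof.
move=> [dg cg Ug].
pose h t := logmod j (gamma t).
pose h' t := Re (zcoord j (derive1 gamma t) / zcoord j (gamma t)).
have dh (t : R) : t \in `[0, 1] -> is_derive t 1 h (h' t).
  by move=> /Ug Ut; have := is_derive_ln_nsq (F := fun s => zcoord j (gamma s)) (Ut j) (cdiff_curve j (dg t)).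
have cz k t : ccont (fun s => zcoord k (gamma s)) t.
  by apply: ccont_zcoord_comp; exact/differentiable_continuous/derivable1_diffP.
have cq k (t : R) : t \in `[0, 1] -> ccont (fun s => zcoord k (derive1 gamma s) / zcoord k (gamma s)) t.
  move=> /Ug Ut; apply: ccontM; first by apply: ccont_zcoord_comp; exact: cg.
  by apply: ccontV => //; exact: Ut.
have ch' : {within `[0, 1]%classic, continuous h'}.
  by apply: continuous_in_subspaceT => t; rewrite inE => t01; case: (cq j t t01).
(* The speed in closed form, continuous on [0, 1] and hence integrable. *)
pose G t := Num.sqrt (\sum_(k < n) nsq (zcoord k (derive1 gamma t) / zcoord k (gamma t))).
have cG : {within `[0, 1]%classic, continuous G}.
  apply: continuous_in_subspaceT => t; rewrite inE => t01.
  apply: (@continuous_cvg _ _ _ _ _ (fun s => \sum_(k < n) nsq (zcoord k (derive1 gamma s) / zcoord k (gamma s)))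
    (@Num.sqrt R)); first exact: sqrt_continuous.
  by apply: cvg_sum_nsq => k; exact: cq.
have cK : compact (`[0, 1]%classic : set R) := @segment_compact _ _ _.
have ih' := continuous_compact_integrable cK ch'.
have iG := continuous_compact_integrable cK cG.
have fcc (t : R) : t \in `[0, 1] -> {for t, continuous h}.
  by move=> t01; apply/differentiable_continuous/derivable1_diffP; case: (dh t t01).
have ftc : (\int[lebesgue_measure]_(t in `[0%R, 1%R]) (h' t)%:E = (h 1)%:E - (h 0)%:E)%E.
  apply: continuous_FTC2 => //.
    split=> [t t01||].
    - by case: (dh t (subset_itv_oo_cc t01)).
    - by apply: cvg_at_right_filter; apply: fcc; rewrite in_itv /= lexx ler01.
    - by apply: cvg_at_left_filter; apply: fcc; rewrite in_itv /= lexx ler01.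
  by move=> t t01; rewrite derive1E (is_derive_val (dh t (subset_itv_oo_cc t01))).
have -> : curve_length g gamma = (\int[lebesgue_measure]_(t in `[0%R, 1%R]) (G t)%:E)%E.
  by apply: eq_integral => t _; rewrite gnorm_torus.
rewrite -abse_EFin -/(h 1) -/(h 0) EFinB -ftc.
apply: (@le_trans _ _ (\int[lebesgue_measure]_(t in `[0%R, 1%R]) `|(h' t)%:E|)%E).
  by apply: le_abse_integral => //; case/integrableP: ih'.
apply: le_integral => //; first exact: integrable_abse.
move=> t; rewrite inE => /Ug Ut.
by rewrite abse_EFin lee_fin /G -gnorm_torus; exact: Re_dlog_le_gnorm.
Qed.

Lemma joined_ge p q l j : joined U g p q l ->
  ((`|logmod j q - logmod j p|)%:E <= l)%E.
Proof.
elim=> [x Ux|gamma x k C _ IH]; first by rewrite subrr normr0.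
apply: le_trans (leeD (curve_length_ge j C) IH).
by rewrite -EFinD lee_fin [leRHS]addrC -(subrKA (logmod j (gamma 1)) (logmod j x)) ler_normD.
Qed.

Lemma dist_ge p q j : ((`|logmod j q - logmod j p|)%:E <= dist U g p q)%E.
Proof. by apply: le_ereal_inf_tmp => l /= /joined_ge. Qed.

(** Relates the Euclidean topology to the distance of the metric: the exponential curve from [q] to
    [p] has direction log(p/q), which is small for [q] near [p]. *)
Lemma near_dist p (e : R) : U p -> 0 < e -> \forall q \near p, (dist U g q p < e%:E)%E.
Proof.
move=> Up e0.
pose w j q := clog (zcoord j p / zcoord j q).
have zp1 j : zcoord j p / zcoord j p = 1 by rewrite divff //; exact: Up.
have cw j : ccont (w j) p.
  apply: ccont_log; first by rewrite zp1 /= ltr01.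
  by apply: ccontZ; apply: ccontV; [exact: Up | exact: ccont_zcoord].
have cD : Num.sqrt (\sum_(j < n) nsq (w j q)) @[q --> p] --> Num.sqrt (\sum_(j < n) nsq (w j p)).
  apply: (@continuous_cvg V R R (nbhs p) _ (fun q => \sum_(j < n) nsq (w j q)) (@Num.sqrt R)).
    exact: sqrt_continuous.
  exact: cvg_sum_nsq.
have w0 : Num.sqrt (\sum_(j < n) nsq (w j p)) < e.
  rewrite big1 ?sqrtr0 // => j _; apply/eqP; rewrite nsq_eq0 /w zp1.
  by rewrite -cexp0 cexpK //= normr0 divr_gt0 ?pi_gt0.
have cRe : \forall q \near p, forall j, 0 < Re (zcoord j p / zcoord j q).
  apply: (@filter_forall V 'I_n (fun j q => 0 < Re (zcoord j p / zcoord j q)) (nbhs p)) => j.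
  have [h _] := ccontZ (zcoord j p) (ccontV (Up j) (ccont_zcoord j p)).
  by apply: (cvgr_gt _ h); rewrite zp1 /= ltr01.
near=> q.
have Uq : U q by near: q; exact: (near_open (@open_torus R n)).
apply: (@le_lt_trans _ _ (Num.sqrt (\sum_(j < n) nsq (w j q)))%:E); last first.
  by rewrite lte_fin; near: q; exact: (cvgr_lt _ cD).
have Req : forall j, 0 < Re (zcoord j p / zcoord j q) by near: q; exact: cRe.
apply: dist_le_exp => // j; rewrite clogK //.
by rewrite mulrC divfK //; exact: Uq.
Unshelve. all: by end_near. Qed.

Definition annulus (a b : R) : set V :=
  [set p | forall j, a <= nsq (zcoord j p) <= b].

Lemma compact_annulus a b : compact (annulus a b).
Proof.
have box : compact [set v : V | forall J, `[- (b + 1), b + 1]%classic (v 0 J)].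
  by apply: (@rV_compact _ _ (fun=> `[- (b + 1), b + 1]%classic)) => J; exact: segment_compact.
apply: subclosed_compact box _.
  have -> : annulus a b = \bigcap_(j in setT)
      ((fun p : V => nsq (zcoord j p)) @^-1` `[a, b]%classic).
    apply/seteqP; split => p /= h j; first by move=> _; rewrite /preimage /= in_itv /=; exact: h.
    by have := h j I; rewrite /= in_itv.
  apply: closed_bigI => j _; apply: preimage_closed; last exact: itv_closed.
  by move=> p _; exact: continuous_nsq (ccont_zcoord j p).
move=> p /= h J; rewrite in_itv /= -ler_norml -(vec_zcoord p) mxE /cpt.
have key x y : x ^+ 2 + y ^+ 2 <= b -> `|x| <= b + 1 /\ `|y| <= b + 1.
  have aux x' y' : x' ^+ 2 + y' ^+ 2 <= b -> `|x'| <= b + 1.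
    move=> xy; have x2 : `|x'| ^+ 2 <= b.
      by rewrite real_normK ?num_real //; apply: le_trans xy; rewrite lerDl sqr_ge0.
    have [x1|x1] := leP `|x'| 1; first by rewrite (le_trans x1) // lerDr (le_trans _ x2) ?sqr_ge0.
    rewrite (le_trans _ (_ : b <= _)) ?lerDl // (le_trans _ x2) // expr2.
    by rewrite ler_peMl // ltW.
  by move=> xy; split; [apply: aux xy | apply: (aux y x); rewrite addrC].
by case: fintype.split => j; have /andP[_ /key[]] := h j.
Qed.

Lemma annulus_torus a b p : 0 < a -> annulus a b p -> U p.
Proof. by move=> a0 h j; rewrite -nsq_gt0 (lt_le_trans a0) //; case/andP: (h j). Qed.

Lemma annulusP p (B : R) : U p -> (forall j, `|logmod j p| <= B) ->
  annulus (expR (- (2 * B))) (expR (2 * B)) p.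
Proof.
move=> Up h j; have n0 : 0 < nsq (zcoord j p) by rewrite nsq_gt0.
have := h j; rewrite /logmod ler_norml => h2.
by rewrite -[nsq _]lnK // !ler_expR; lra.
Qed.

Lemma complete_torus : complete_metric U g.
Proof.
move=> u Uu cu.
have [N0 hN0] := cu 1 ltr01.
(* From [N0] on, all terms are within distance 1 of [u N0], and the functions log|z_j| are
   1-Lipschitz. The factor 2 in [K] comes from [annulus] being defined by squared moduli. *)
pose B := \sum_(j < n) `|logmod j (u N0)| + 1.
pose K := annulus (expR (- (2 * B))) (expR (2 * B)).
have uK i : (N0 <= i)%N -> K (u i).
  move=> iN; apply: annulusP => // j.
  have h : `|logmod j (u i) - logmod j (u N0)| <= 1.
    have := le_lt_trans (dist_ge (u N0) (u i) j) (hN0 N0 i (leqnn _) iN).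
    by rewrite lte_fin => /ltW.
  rewrite -[logmod j (u i)](subrK (logmod j (u N0))).
  apply: (le_trans (ler_normD _ _)); rewrite addrC; apply: lerD h.
  by rewrite (bigD1 j) //= lerDl sumr_ge0.
have : (u @ \oo) K by exists N0 => // i /= iN; exact: uK.
case/(compact_annulus (F := u @ \oo)) => p [Kp clp].
have Up : U p by apply: annulus_torus Kp; exact: expR_gt0.
exists p => // e e0.
have e2 : 0 < e / 2 by rewrite divr_gt0.
have [N hN] := cu _ e2.
have uN : (u @ \oo) [set u i | i in [set i | (N <= i)%N]].
  by exists N => // i /= iN; exists i.
(* The cluster point is the limit: some late term is within e/2 of [p], and all late terms are
   within e/2 of that one. *)
have [_ [[i /= iN <-] hi]] := clp _ _ uN (near_dist Up e2).
exists N => k kN; rewrite [e]splitr; apply: dist_trans_lt hi.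
exact: hN.
Qed.

End Curves.

(** * The exponential map *)

Section SmoothClasses.
Variables (R : realType) (m : nat).
Local Notation V := 'rV[R]_m.

(** Smoothness without computing higher derivatives: it suffices to find a class of continuous
    functions, closed under partial derivatives, that contains the components of the map. *)
Lemma smooth_on_class (A : set V) (S : set (V -> R)) (F : V -> V) : open A ->
  (forall h x, S h -> A x -> h @ x --> h x) ->
  (forall h a, S h -> exists2 h', S h' & forall x, A x -> is_derive x (delta_mx 0 a : V) h (h' x)) ->
  (forall c, exists2 h, S h & forall x, A x -> F x 0 c = h x) ->
  smooth_on A F.
Proof.
move=> oA cS dS SF c s.
have [h Sh hE] : exists2 h, S h & forall x, A x -> pderivs s (fun y => F y 0 c) x = h x.
  elim: s => [|a s [h Sh hE]] /=; first exact: SF.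
  have [h' Sh' hh'] := dS h a Sh; exists h' => // x Ax.
  by rewrite (pderiv_eq_on_open oA a Ax hE) /pderiv (is_derive_val (hh' x Ax)).
move=> x Ax; cbv zeta.
have nE : \forall y \near x, h y = pderivs s (fun y => F y 0 c) y.
  by apply: filterS (near_open oA Ax) => y /hE.
split=> [|a]; last by have [h' _ hh'] := dS h a Sh; case: (is_derive_near nE (hh' x Ax)).
have -> : {for x, continuous (pderivs s (fun y => F y 0 c))} =
    (pderivs s (fun y => F y 0 c) @ x --> pderivs s (fun y => F y 0 c) x) by [].
rewrite hE //; apply: cvg_trans (cS _ _ Sh Ax).
exact: (@near_eq_cvg _ _ (nbhs x) _ _ _ nE).
Qed.

End SmoothClasses.

Section InjectivityRadius.
Variables (R : realType) (n : nat).
Local Notation V := 'rV[R]_(n + n).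
Local Notation e a := (delta_mx 0 a : V).
Local Notation Cn := ('I_n -> R[i]).
Local Notation g := (@torus_metric R n).
Local Notation U := (@torus R n).
Implicit Types (p q v : V) (j : 'I_n).

Lemma Im_dlog_le_gnorm p v j : U p -> `|Im (zcoord j v / zcoord j p)| <= gnorm g p v.
Proof.
move=> Up; rewrite gnorm_torus -sqrtr_sqr ler_sqrt; last first.
  by apply: sumr_ge0 => k _; exact: nsq_ge0.
rewrite (bigD1 j) //= -[leLHS]addr0 lerD ?sumr_ge0 // => [|k _]; last exact: nsq_ge0.
by rewrite /nsq lerDr sqr_ge0.
Qed.

(** The geodesic equation thus reads z_j'' = z_j'^2 / z_j, which the exponential curves solve. *)
Lemma christoffel_quadratic p v c : U p ->
  \sum_a \sum_b christoffel g c a b p * v 0 a * v 0 b =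
  cpt c (fun j => - (zcoord j v * zcoord j v) / zcoord j p).
Proof.
move=> Up.
have lin u : \sum_a v 0 a * cpt c (fun j => zcoord j (e a) * u j) = cpt c (fun j => zcoord j v * u j).
  under eq_bigr do rewrite -cptZ.
  rewrite -cpt_sum; congr cpt; apply/funext => j.
  by rewrite [in RHS]zcoord_sum_delta mulr_suml; apply: eq_bigr => a _; rewrite mulrA.
transitivity (\sum_a v 0 a * cpt c (fun j => zcoord j (e a) * (- zcoord j v / zcoord j p))).
  apply: eq_bigr => a _.
  transitivity (v 0 a * \sum_b v 0 b * cpt c (fun j => zcoord j (e b) * (- zcoord j (e a) / zcoord j p))).
    rewrite mulr_sumr; apply: eq_bigr => b _; rewrite christoffel_torus //.
    rewrite mulrAC mulrC; congr (_ * _); rewrite mulrC; congr (_ * cpt _ _).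
    by apply/funext => j; ring.
  by rewrite lin; congr (_ * cpt _ _); apply/funext => j; ring.
by rewrite lin; congr cpt; apply/funext => j; ring.
Qed.

(** The exponential map at [p], a translation in logarithmic coordinates; [tlog p] is its inverse
    where the principal branch of the logarithm applies. *)
Definition texp p v : V := vec (fun j => zcoord j p * cexp (zcoord j v / zcoord j p)).
Definition tlog p q : V := vec (fun j => zcoord j p * clog (zcoord j q / zcoord j p)).

Lemma is_exp_texp p v : U p -> is_exp U g p v (texp p v).
Proof.
move=> Up; pose c j := zcoord j p; pose w j := zcoord j v / zcoord j p.
have wc : (fun j => w j * c j) = (fun j => zcoord j v).
  by apply/funext => j; rewrite /w /c divfK //; exact: Up.
exists (expcurve c w); split.
- move=> t _; have Ut := torus_expcurve w t Up; split => //.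
  + by case: (derivable_expcurve c w t).
  + by rewrite derive1_expcurve; case: (derivable_expcurve (fun j => w j * c j) w t).
  + move=> a; rewrite !derive1_expcurve christoffel_quadratic // mxE -cptD -[RHS](cpt0 _ a).
    congr cpt; apply/funext => j; rewrite !zcoord_vec.
    have cj : c j != 0 := Up j.
    have ej := cexp_neq0 (t%:C%C * w j).
    by field; rewrite cj ej.
- by rewrite expcurve0 vec_zcoord.
- by rewrite derive1_expcurve expcurve0 wc vec_zcoord.
- by apply: vec_inj => j; rewrite !zcoord_vec mul1r.
Qed.

Lemma vec_class (P : set (V -> R)) (F : V -> Cn) (A : set V) :
  (forall j (C : R[i]), exists2 h, P h & forall x, A x -> Re (C * F x j) = h x) ->
  forall c, exists2 h, P h & forall x, A x -> vec (F x) 0 c = h x.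
Proof.
move=> PF c.
(* The imaginary part is the real part after multiplication by -i, so one constant [C] covers both
   kinds of components. *)
have [[j C] jC] : {jC : 'I_n * R[i] | forall x, vec (F x) 0 c = Re (jC.2 * F x jC.1)}.
  case: (fintype.splitP c) => j cj.
    exists (j, 1) => x; rewrite mxE mul1r (_ : c = lshift n j) ?cpt_lshift //.
    exact: val_inj.
  exists (j, - 'i%C) => x; rewrite mxE (_ : c = rshift n j) ?cpt_rshift; last exact: val_inj.
  by rewrite ReM /=; ring.
by have [h Ph hE] := PF j C; exists h => // x Ax; rewrite jC /= hE.
Qed.

Lemma smooth_texp p (A : set V) : U p -> open A -> smooth_on A (texp p).
Proof.
move=> Up oA.
pose E j v := cexp (zcoord j v / zcoord j p).
have cE j v : ccont (E j) v.
  by apply/ccont_exp/ccontM; [exact: ccont_zcoord | exact: ccont_cst].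
have dE j v a : cdiff (E j) v (e a) (E j v * (zcoord j (e a) / zcoord j p)).
  apply: cdiff_exp; apply: cdiff_eq (cdiffM (cdiff_zcoord j v (e a)) (cdiff_cst _ _ _)) _.
  by rewrite mulr0 addr0.
pose S := [set h | exists j C, h = (fun v => Re (C * E j v))].
apply: (@smooth_on_class _ _ A S) => //.
- by move=> h x [j [C ->]] _; case: (ccontZ C (cE j x)).
- move=> h a [j [C ->]]; exists (fun v => Re (C * (zcoord j (e a) / zcoord j p) * E j v)).
    by exists j, (C * (zcoord j (e a) / zcoord j p)).
  move=> x _; have [h1 _] := cdiffZ C (dE j x a).
  by apply: (is_derive_eq h1); congr Re; ring.
- apply: (@vec_class S) => j C; exists (fun v => Re (C * zcoord j p * E j v)).
    by exists j, (C * zcoord j p).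
  by move=> x _; rewrite mulrA.
Qed.

Lemma smooth_tlog p (A : set V) : U p -> open A ->
  (forall q j, A q -> 0 < Re (zcoord j q / zcoord j p)) -> smooth_on A (tlog p).
Proof.
move=> Up oA A0.
have z0 q j : A q -> zcoord j q != 0.
  by move=> Aq; have := A0 q j Aq; apply: contraTneq => ->; rewrite mul0r ltxx.
pose L j q := clog (zcoord j q / zcoord j p).
have cL j q : A q -> ccont (L j) q.
  move=> Aq; apply: ccont_log; first exact: A0.
  by apply: ccontM; [exact: ccont_zcoord | exact: ccont_cst].
have dL j q a : A q -> cdiff (L j) q (e a) (zcoord j (e a) / zcoord j q).
  move=> Aq; have zq := z0 q j Aq; have zp := Up j.
  apply: (cdiff_eq (cdiff_log (F := fun q => zcoord j q / zcoord j p) (A0 q j Aq)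
    (cdiffM (cdiff_zcoord j q (e a)) (cdiff_cst (zcoord j p)^-1 q (e a))))).
  by field; rewrite zq zp.
have dX j (k : int) q a : A q -> cdiff (fun q => zcoord j q ^ k) q (e a)
    (k%:~R * zcoord j (e a) * zcoord j q ^ (k - 1)).
  move=> Aq; have zq := z0 q j Aq.
  have h : logdiff (zcoord j) q (e a) (zcoord j (e a) / zcoord j q).
    by split=> //; rewrite mulrC divfK //; exact: cdiff_zcoord.
  apply: cdiff_eq (proj2 (logdiffXz k h)) _.
  by rewrite expfzDr // exprN1; ring.
(* One differentiation turns the logarithm into 1/z_j; from then on only integer powers of z_j
   occur. *)
pose S := [set h | exists j C, h = (fun q => Re (C * L j q)) \/
                   exists k : int, h = (fun q => Re (C * zcoord j q ^ k))].
apply: (@smooth_on_class _ _ A S) => //.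
- move=> h x [j [C [->|[k ->]]]] Ax; first by case: (ccontZ C (cL j x Ax)).
  by case: (ccontZ C (ccontXz k (z0 x j Ax) (ccont_zcoord j x))).
- move=> h a [j [C [->|[k ->]]]].
    exists (fun q => Re (C * zcoord j (e a) * zcoord j q ^ (-1)%Z)).
      by exists j, (C * zcoord j (e a)); right; exists (-1)%Z.
    move=> x Ax; have [h1 _] := cdiffZ C (dL j x a Ax).
    by apply: (is_derive_eq h1); rewrite exprN1 mulrA.
  exists (fun q => Re (C * (k%:~R * zcoord j (e a)) * zcoord j q ^ (k - 1))).
    by exists j, (C * (k%:~R * zcoord j (e a))); right; exists (k - 1).
  move=> x Ax; have [h1 _] := cdiffZ C (dX j k x a Ax).
  by apply: (is_derive_eq h1); rewrite mulrA.
- apply: (@vec_class S) => j C; exists (fun q => Re (C * zcoord j p * L j q)).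
    by exists j, (C * zcoord j p); left.
  by move=> x _; rewrite mulrA.
Qed.

(** A radius of 1 is below pi/2, so that on the ball the imaginary parts of v_j / z_j stay in the
    strip where [clog] inverts [cexp]. The radius does not depend on [p]. *)
Lemma exp_diffeo_unit_ball p : U p -> exp_diffeo_on_ball U g p 1.
Proof.
move=> Up; exists (texp p) => [v _|]; first exact: is_exp_texp.
have gE v : (gnorm g p v < 1) = (\sum_(j < n) nsq (zcoord j v / zcoord j p) < 1).
  rewrite gnorm_torus -[X in _ < X]sqrtr1 ltr_sqrt //.
have im v j : gnorm g p v < 1 -> `|Im (zcoord j v / zcoord j p)| < pi / 2.
  move=> v1; apply: (le_lt_trans (Im_dlog_le_gnorm v j Up)); apply: (lt_le_trans v1).
  by rewrite ler_pdivlMr // mul1r pi_ge2.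
pose A := [set v | gnorm g p v < 1].
(* An explicit form of the image of the ball, from which it is seen to be open and to lie in the
   domain of the logarithm. *)
pose B := [set q | (forall j, 0 < Re (zcoord j q / zcoord j p)) /\
                   \sum_(j < n) nsq (clog (zcoord j q / zcoord j p)) < 1].
have cq j q : ccont (fun q => zcoord j q / zcoord j p) q.
  by apply: ccontM; [exact: ccont_zcoord | exact: ccont_cst].
have oA : open A.
  rewrite openE => v; rewrite /A /= gE => v1; rewrite /interior /=.
  have h : \forall x \near v, \sum_(j < n) nsq (zcoord j x / zcoord j p) < 1.
    exact: (cvgr_lt _ (cvg_sum_nsq (fun j => cq j v)) _ v1).
  by apply: filterS h => x; rewrite /= gE.
have oB : open B.
  rewrite openE => q [q0 q1]; rewrite /interior /=; apply: filterI.
    apply: (@filter_forall V 'I_n (fun j q => 0 < Re (zcoord j q / zcoord j p)) (nbhs q)) => j.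
    by have [h _] := cq j q; exact: (cvgr_gt _ h).
  exact: (cvgr_lt _ (cvg_sum_nsq (fun j => ccont_log (q0 j) (cq j q))) _ q1).
have zE v j : zcoord j (texp p v) / zcoord j p = cexp (zcoord j v / zcoord j p).
  by rewrite zcoord_vec mulrAC divff ?mul1r //; exact: Up.
have zL q j : zcoord j (tlog p q) / zcoord j p = clog (zcoord j q / zcoord j p).
  by rewrite zcoord_vec mulrAC divff ?mul1r //; exact: Up.
have EA : texp p @` A = B.
  apply/seteqP; split => [_ [v v1 <-]|q [q0 q1]].
    split=> [j|]; first by rewrite zE; apply: Re_cexp_gt0; exact: im.
    by under eq_bigr do rewrite zE cexpK ?im //; rewrite -gE.
  exists (tlog p q); first by rewrite /A /= gE; under eq_bigr do rewrite zL.
  apply: vec_inj => j; rewrite zcoord_vec zL clogK // mulrC divfK //; exact: Up.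
rewrite /diffeo_on_image -/A EA; split=> //; first exact: smooth_texp.
exists (tlog p); first by apply: smooth_tlog => // q j [].
move=> v; rewrite inE => v1; apply: vec_inj => j.
by rewrite zcoord_vec zE cexpK ?im // mulrC divfK //; exact: Up.
Qed.

Lemma injectivity_radius_torus : (0 < injectivity_radius U g)%E.
Proof.
apply: (@lt_le_trans _ _ 1%E) => //; apply: le_ereal_inf_tmp => _ [p Up <-].
apply: ereal_sup_ubound; exists 1 => //=; split=> //; exact: exp_diffeo_unit_ball.
Qed.

Lemma bounded_geometry_torus : bounded_geometry U g.
Proof.
split; [exact: complete_torus | exact: injectivity_radius_torus |].
move=> l; exists 0 => p Up; rewrite tensor_norm_eq0 // => s.
apply: (@iter_covD_eq0 _ _ U g (@open_torus R n) l 4 (curvature_tensor g)) => // {}s q Uq.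
by apply: big1 => a _; rewrite curvature_torus // mulr0.
Qed.

End InjectivityRadius.

(** * Growth of Laurent polynomials *)

Section Growth.
Variables (R : realType) (n : nat).
Local Notation V := 'rV[R]_(n + n).
Local Notation e a := (delta_mx 0 a : V).
Local Notation g := (@torus_metric R n).
Local Notation U := (@torus R n).
Implicit Types (p q z : V) (c : laurent R n) (alpha : 'rV[int]_n) (x y : 'I_n -> R).

Lemma logmod_normc j p : U p -> logmod j p = ln (normc (zcoord j p)).
Proof.
move=> Up; have z0 : 0 < normc (zcoord j p) by rewrite normc_gt0; exact: Up.
by rewrite /logmod -normc_sqr lnXn // mulr2n; field.
Qed.

Lemma expR_logmod j p : U p -> expR (logmod j p) = normc (zcoord j p).
Proof. by move=> Up; rewrite logmod_normc // lnK // posrE normc_gt0; exact: Up. Qed.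

(** If all |log|z_j|| were at most [D], an exponential curve would join [z] to [z0] with log-moduli
    changing by at most |log|z0_j|| + D and arguments by at most pi, hence with length at most the
    chosen bound. *)
Lemma far_point z0 (D : R) : U z0 -> exists D', forall z, U z ->
  (D'%:E < dist U g z z0)%E -> exists j, D < `|logmod j z|.
Proof.
move=> Uz0; exists (Num.sqrt (\sum_(j < n) ((`|logmod j z0| + D) ^+ 2 + pi ^+ 2))).
move=> z Uz far; apply: contrapT => near_z; move: far; apply/negP; rewrite -leNgt.
have zD j : `|logmod j z| <= D.
  by rewrite leNgt; apply/negP => h; apply: near_z; exists j.
have /choice[w hw] : forall j, exists w, [/\ cexp w = zcoord j z0 / zcoord j z,
    Re w = ln (normc (zcoord j z0 / zcoord j z)) & `|Im w| <= pi].
  by move=> j; apply: polar_log; rewrite mulf_neq0 ?invr_neq0.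
apply: (@le_trans _ _ (Num.sqrt (\sum_(j < n) nsq (w j)))%:E).
  by apply: dist_le_exp => // j; have [-> _ _] := hw j; rewrite mulrC divfK //; exact: Uz.
rewrite lee_fin ler_sqrt; last by apply: sumr_ge0 => j _; rewrite addr_ge0 ?sqr_ge0.
apply: ler_sum => j _; have [_ Rew Imw] := hw j.
rewrite /nsq -(real_normK (num_real (Re (w j)))) -(real_normK (num_real (Im (w j)))).
have pi0 := pi_ge0 R.
have D0 : 0 <= D := le_trans (normr_ge0 _) (zD j).
have hpi : forall b : R, 0 <= b -> `|Im (w j)| <= b -> `|Im (w j)| ^+ 2 <= b ^+ 2.
  by move=> b b0 hb; rewrite ler_pXn2r ?nnegrE.
apply: lerD; last exact: hpi.
rewrite ler_pXn2r ?nnegrE ?addr_ge0 //.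
rewrite Rew normcM normcV lnM ?posrE ?invr_gt0 ?normc_gt0 // lnV ?posrE ?normc_gt0 //.
rewrite -!logmod_normc //; apply: (le_trans (ler_normB _ _)).
by rewrite lerD2l.
Qed.

Definition dot alpha x : R := \sum_(j < n) (alpha 0 j)%:~R * x j.

Lemma dotD alpha x y : dot alpha (fun j => x j + y j) = dot alpha x + dot alpha y.
Proof. by rewrite /dot -big_split; apply: eq_bigr => j _; rewrite mulrDr. Qed.

Lemma lattice_pt_dot alpha (u : 'rV[R]_n) :
  (lattice_pt R alpha *m u^T) 0 0 = dot alpha (u 0).
Proof. by rewrite mxE; apply: eq_bigr => j _; rewrite !mxE. Qed.

Lemma expR_dot alpha x : expR (dot alpha x) = \prod_(j < n) expR (x j) ^ alpha 0 j.
Proof.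
rewrite /dot (big_morph _ (@expRD R) (expR0 R)); apply: eq_bigr => j _.
case: (alpha 0 j) => k; first by rewrite -exprnP expRM_natl.
by rewrite NegzE -exprnN mulrNz mulNr expRN expRM_natl.
Qed.

Lemma normc_monomial alpha p : U p ->
  normc (monomial alpha p) = expR (dot alpha (fun j => logmod j p)).
Proof.
move=> Up; rewrite normc_prod expR_dot; apply: eq_bigr => j _.
by rewrite normcXz expR_logmod.
Qed.

Lemma dot_bound alpha y (B : R) : (forall j, `|y j| <= B) ->
  `|dot alpha y| <= (\sum_(j < n) `|(alpha 0 j)%:~R : R|) * B.
Proof.
move=> yB; rewrite mulr_suml; apply: (le_trans (ler_norm_sum _ _ _)).
by apply: ler_sum => j _; rewrite normrM ler_wpM2l.
Qed.

(** On the torus this is |z^alpha|, by [normc_monomial]. *)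
Definition absmono alpha p : R := expR (dot alpha (fun j => logmod j p)).
Definition abssum c p : R := \sum_(alpha <- finsupp c) absmono alpha p.

Lemma absmono_le c alpha p : alpha \in finsupp c -> absmono alpha p <= abssum c p.
Proof.
move=> ac; rewrite /abssum (big_rem alpha) //= lerDl sumr_ge0 // => b _.
exact: expR_ge0.
Qed.

(** The exponent is a weighted mean of the numbers alpha.log|z|, each at most the logarithm of
    [abssum]. *)
Lemma polytope_ineq c (v : 'rV[R]_n) p : newton_polytope c v ->
  expR ((v *m (\row_j logmod j p)^T) 0 0) <= abssum c p.
Proof.
move=> [w [w0 w1 ->]].
(* The weights add up to 1, so the support is nonempty and [abssum] is positive. *)
have [[a ac]|nA] := pselect (exists a, a \in finsupp c); last first.
  move: w1; rewrite big_seq big1 => [/esym/eqP|i ic]; first by rewrite oner_eq0.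
  by case: nA; exists i.
have S0 : 0 < abssum c p := lt_le_trans (expR_gt0 _) (absmono_le p ac).
rewrite -[leRHS]lnK ?posrE // ler_expR mulmx_suml summxE.
rewrite -[leRHS]mul1r -w1 mulr_suml !big_seq; apply: ler_sum => i ic.
rewrite -scalemxAl mxE lattice_pt_dot ler_wpM2l //.
rewrite -ler_expR lnK ?posrE //; apply: le_trans (absmono_le p ic).
by rewrite ler_expR le_eqVlt; apply/orP; left; apply/eqP; apply: eq_bigr => j _; rewrite mxE.
Qed.

(** A ball of radius [r] about 0 lies in the polytope; the previous bound is applied to the points
    at r/2 and -r/2 on the coordinate axes. *)
Lemma abssum_growth c : convenient c -> exists2 d : R, 0 < d &
  forall p j, expR (d * `|logmod j p|) <= abssum c p.
Proof.
move=> /nbhs_ballP [r /= r0 hr].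
exists (r / 2); first by rewrite divr_gt0.
move=> p j; set s := logmod j p.
(* The sign of log|z_j| selects the half-axis on which the pairing with log|z| is r/2 times
   |log|z_j||. *)
pose v : 'rV[R]_n := (r / 2 * Num.sg s) *: delta_mx 0 j.
have Pv : newton_polytope c v.
  apply: hr; split=> // i k; rewrite !mxE /ball /= sub0r normrN !normrM.
  have s1 : `|Num.sg s| <= 1 by rewrite normr_sg; case: (s != 0).
  have d1 : `|((i == 0) && (k == j))%:R : R| <= 1 by rewrite normr_nat; case: (_ && _).
  apply: (@le_lt_trans _ _ (r / 2)); last by rewrite ltr_pdivrMr // ltr_pMr // ltr1n.
  rewrite -normrM gtr0_norm ?divr_gt0 // -[leRHS]mulr1 -[leRHS]mulr1.
  by rewrite ler_pM ?mulr_ge0 ?divr_ge0 ?ler_wpM2l ?divr_ge0 // ltW.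
have := polytope_ineq p Pv; congr (expR _ <= _).
rewrite -scalemxAl mxE -rowE !mxE -/s -[r / 2 * _ * _]mulrA; congr (_ * _).
by rewrite -normrEsg.
Qed.

Lemma frame_deriv_le c J p : U p -> normc (frame_deriv c J p) <=
  (\sum_(alpha <- finsupp c) normc (c alpha * \prod_(a <- J) frame_weight R alpha a)) * abssum c p.
Proof.
move=> Up; apply: (le_trans (normc_sum _ _ _)).
rewrite mulr_suml !big_seq; apply: ler_sum => a ac.
by rewrite normcM normc_monomial // ler_wpM2l ?normc_ge0 // absmono_le.
Qed.

Lemma nabla_norm_le c k : exists2 C : R, 0 <= C & forall p, U p ->
  nabla_norm g k (laurent_eval c) p <= C * abssum c p.
Proof.
pose K (J : seq 'I_(n + n)) := \sum_(alpha <- finsupp c)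
  normc (c alpha * \prod_(a <- J) frame_weight R alpha a).
have K0 J : 0 <= K J by apply: sumr_ge0 => a _; exact: normc_ge0.
exists (Num.sqrt (\sum_(J : (k + 0).-tuple 'I_(n + n)) K J ^+ 2)); first exact: sqrtr_ge0.
move=> p Up; have S0 : 0 <= abssum c p by apply: sumr_ge0 => a _; exact: expR_ge0.
rewrite nabla_norm_laurent //.
rewrite -[X in _ * X]ger0_norm // -sqrtr_sqr -sqrtrM; last by apply: sumr_ge0 => J _; exact: sqr_ge0.
rewrite ler_sqrt; last by rewrite mulr_ge0 ?sqr_ge0 // sumr_ge0 // => J _; exact: sqr_ge0.
rewrite mulr_suml; apply: ler_sum => J _.
by rewrite -normc_sqr -exprMn ler_pXn2r ?nnegrE ?mulr_ge0 ?normc_ge0 // frame_deriv_le.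
Qed.

Lemma frame_deriv1_le c a p : U p ->
  normc (frame_deriv c [:: a] p) <= nabla_norm g 1 (laurent_eval c) p.
Proof.
move=> Up; rewrite nabla_norm_laurent // normc_sqrt ler_sqrt; last first.
  by apply: sumr_ge0 => J _; exact: nsq_ge0.
rewrite (bigD1 [tuple a]) //= lerDl sumr_ge0 // => J _; exact: nsq_ge0.
Qed.

End Growth.

Lemma eq_sum_seq_cond (T : eqType) (S : nmodType) (r : seq T) (P : pred T) (F G : T -> S) :
  {in r, forall i, P i -> F i = G i} ->
  \sum_(i <- r | P i) F i = \sum_(i <- r | P i) G i.
Proof.
move=> FG; rewrite big_seq_cond [RHS]big_seq_cond.
by apply: eq_bigr => i /andP[ir Pi]; exact: FG.
Qed.

Lemma ler_sum_seq_cond (T : eqType) (S : numDomainType) (r : seq T) (P : pred T) (F G : T -> S) :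
  {in r, forall i, P i -> F i <= G i} -> {in r, forall i, 0 <= G i} ->
  \sum_(i <- r | P i) F i <= \sum_(i <- r) G i.
Proof.
move=> FG G0; rewrite big_mkcond /= big_seq [leRHS]big_seq; apply: ler_sum => i ir.
by case: ifP => [/FG|_]; [exact | exact: G0].
Qed.

(** * Faces of the Newton polytope and facial polynomials *)

Section Faces.
Variables (R : realType) (n : nat).
Local Notation V := 'rV[R]_(n + n).
Local Notation e a := (delta_mx 0 a : V).
Local Notation U := (@torus R n).
Implicit Types (p q z : V) (c : laurent R n) (alpha : 'rV[int]_n).

Lemma frame_weight_lshift alpha (j : 'I_n) :
  frame_weight R alpha (lshift n j) = (alpha 0 j)%:~R.
Proof.
rewrite /frame_weight (bigD1 j) //= zcoord_lshift eqxx mulr1 big1 ?addr0 //.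
by move=> k /negPf kj; rewrite zcoord_lshift kj mulr0.
Qed.

(** Sums over the support of a facial polynomial become filtered sums over the support of [c], where
    the face is known only through the predicate [P]. *)
Lemma face_part_sum c (F : set 'rV[R]_n) (h : 'rV[int]_n -> R[i]) (P : pred 'rV[int]_n) :
  {in finsupp c, forall alpha, `[< F (lattice_pt R alpha) >] = P alpha} ->
  \sum_(alpha <- finsupp (face_part c F)) face_part c F alpha * h alpha =
  \sum_(alpha <- finsupp c | P alpha) c alpha * h alpha.
Proof.
move=> FP; set d := face_part c F.
have dE alpha : d alpha = if alpha \in finsupp c then if P alpha then c alpha else 0 else 0.
  by rewrite fsfunE; case: ifP => // ac; rewrite FP.
have sub alpha : alpha \in finsupp d -> alpha \in finsupp c.
  by rewrite mem_finsupp dE; case: ifP => //; rewrite eqxx.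
transitivity (\sum_(alpha <- finsupp c | alpha \in finsupp d) d alpha * h alpha).
  rewrite -[RHS]big_filter; apply: perm_big; apply: uniq_perm; rewrite ?filter_uniq ?fset_uniq //.
  move=> alpha; rewrite mem_filter; apply/idP/idP => [ad|/andP[]//].
  by rewrite ad sub.
rewrite big_mkcond [RHS]big_mkcond /= !big_seq; apply: eq_bigr => alpha ac.
rewrite mem_finsupp dE ac; case: (P alpha); last by rewrite eqxx.
by case: eqVneq => // ->; rewrite mul0r.
Qed.

Lemma lattice_pt_polytope c alpha : alpha \in finsupp c ->
  newton_polytope c (lattice_pt R alpha).
Proof.
move=> ac; exists (fun b => (b == alpha)%:R); split => [b||]; first exact: ler0n.
  rewrite (big_rem alpha) //= eqxx big_seq big1 ?addr0 // => b.
  by rewrite mem_rem_uniq ?fset_uniq // inE => /andP[/negPf ->].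
rewrite (big_rem alpha) //= eqxx scale1r big_seq big1 ?addr0 // => b.
by rewrite mem_rem_uniq ?fset_uniq // inE => /andP[/negPf ->] _; rewrite scale0r.
Qed.

Lemma polytope_dot_le c (u : 'rV[R]_n) (m : R) v : newton_polytope c v ->
  {in finsupp c, forall alpha, dot alpha (u 0) <= m} -> (v *m u^T) 0 0 <= m.
Proof.
move=> [w [w0 w1 ->]] hm; rewrite mulmx_suml summxE -[leRHS]mul1r -w1 mulr_suml.
rewrite !big_seq; apply: ler_sum => b bc.
by rewrite -scalemxAl mxE lattice_pt_dot ler_wpM2l // hm.
Qed.

(** The squared gradient norm of the part of the polynomial with exponents in [P]. *)
Definition initial_normsq c (P : pred 'rV[int]_n) q : R :=
  \sum_a nsq (\sum_(alpha <- finsupp c | P alpha) c alpha * (frame_weight R alpha a * monomial alpha q)).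

(* A facial polynomial is quasi-homogeneous, of weight [m != 0]; Euler's
   identity then makes it vanish where all its logarithmic derivatives do. *)
Lemma initial_normsq_gt0 c (P : pred 'rV[int]_n) (u : 'rV[R]_n) (m : R) alpha0 q :
  nondegenerate c -> alpha0 \in finsupp c -> P alpha0 -> 0 < m ->
  {in finsupp c, forall alpha, P alpha -> dot alpha (u 0) = m} ->
  {in finsupp c, forall alpha, ~~ P alpha -> dot alpha (u 0) < m} ->
  U q -> 0 < initial_normsq c P q.
Proof.
move=> nd a0c Pa0 m0 uP uN Uq.
have um : {in finsupp c, forall alpha, dot alpha (u 0) <= m}.
  by move=> b bc; case: (boolP (P b)) => [/uP->//|/uN/ltW]; exact.
pose F : set 'rV[R]_n := [set x | newton_polytope c x /\
  forall y, newton_polytope c y -> (y *m u^T) 0 0 <= (x *m u^T) 0 0].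
(* The maximum of [u] over the polytope is [m], and the exponents that attain it are those in
   [P]. *)
have FP : {in finsupp c, forall alpha, `[< F (lattice_pt R alpha) >] = P alpha}.
  move=> b bc; apply/asboolP/idP => [[_ h]|Pb].
    apply: contraT => nPb; have := h _ (lattice_pt_polytope a0c).
    by rewrite !lattice_pt_dot (uP _ a0c) // leNgt uN.
  split=> [|y Py]; first exact: lattice_pt_polytope.
  by rewrite lattice_pt_dot (uP _ bc Pb); exact: polytope_dot_le Py um.
have fF : is_face (newton_polytope c) F.
  split; last by exists u.
  by exists (lattice_pt R alpha0); apply/asboolP; rewrite FP.
rewrite lt_def sumr_ge0 ?andbT => [|a _]; last exact: nsq_ge0.
apply/negP => /eqP/psumr_eq0P van; apply: (nd F fF); exists q.
have Va a : \sum_(alpha <- finsupp c | P alpha) c alpha * (frame_weight R alpha a * monomial alpha q) = 0.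
  by apply/eqP; rewrite -nsq_eq0 van // => b _; exact: nsq_ge0.
split=> // [|j]; last first.
  rewrite zcoord_dz // /frame_deriv.
  under eq_bigr do rewrite big_seq1 -mulrA.
  by rewrite (face_part_sum _ FP).
(* Euler's identity: [m] times the facial polynomial is the combination of its logarithmic
   derivatives with coefficients u_j. *)
rewrite /laurent_eval (face_part_sum _ FP); apply: (@mulfI _ (m%:C%C)).
  by rewrite eq_complex /= eqxx andbT gt_eqF.
rewrite mulr0 mulr_sumr.
transitivity (\sum_(j < n) (u 0 j)%:C%C *
    \sum_(alpha <- finsupp c | P alpha) c alpha * (frame_weight R alpha (lshift n j) * monomial alpha q)); last first.
  by apply: big1 => j _; rewrite Va mulr0.
under [RHS]eq_bigr do rewrite mulr_sumr.
rewrite exchange_big /=; apply: eq_sum_seq_cond => b bc Pb.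
rewrite -/(monomial b q) -(uP b bc Pb) /dot rmorph_sum /= mulr_suml.
by apply: eq_bigr => j _; rewrite frame_weight_lshift rmorphM /= rmorph_int; ring.
Qed.

(** A continuous positive function has a positive minimum on the compact annulus. *)
Lemma initial_normsq_lower c (P : pred 'rV[int]_n) (a b : R) : 0 < a ->
  (forall q, U q -> 0 < initial_normsq c P q) ->
  exists2 d : R, 0 < d & forall q, annulus a b q -> d <= initial_normsq c P q.
Proof.
move=> a0 pos; have [[q0 hq0]|ne] := pselect (annulus (R := R) (n := n) a b !=set0); last first.
  by exists 1 => // q hq; case: ne; exists q.
have [|q1 hq1 qmin] := @compact_EVT_min _ _ (initial_normsq c P) _ (ex_intro _ _ hq0) (@compact_annulus R n a b).
  apply: continuous_in_subspaceT => q; rewrite inE => hq.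
  have Uq := annulus_torus a0 hq.
  apply: (cvg_sum_nsq (F := fun a q => \sum_(alpha <- finsupp c | P alpha)
    c alpha * (frame_weight R alpha a * monomial alpha q))) => x.
  under [X in ccont X]eq_fun do rewrite -big_filter.
  apply: ccont_sum => i; apply: ccontZ; apply: ccontZ; apply: ccont_prod => j.
  by apply: ccontXz; [exact: Uq | exact: ccont_zcoord].
exists (initial_normsq c P q1).
  by apply: pos; rewrite inE in hq1; exact: annulus_torus hq1.
by move=> q hq; apply: qmin; rewrite inE.
Qed.

End Faces.

(** * The gradient near infinity and strong ellipticity *)

Section LowerBound.
Variables (R : realType) (n : nat).
Local Notation V := 'rV[R]_(n + n).
Local Notation g := (@torus_metric R n).
Local Notation U := (@torus R n).
Implicit Types (p q z : V) (c : laurent R n) (alpha : 'rV[int]_n).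

Lemma filter_seq (X : Type) (T : eqType) (G : set_system X) (FG : Filter G)
    (s : seq T) (Q : T -> set X) :
  (forall a, a \in s -> G (Q a)) -> G [set i | forall a, a \in s -> Q a i].
Proof.
elim: s => [|a s IH] h; first by apply: filterS filterT.
have h1 := h a (mem_head _ _).
have h2 : G [set i | forall b, b \in s -> Q b i].
  by apply: IH => b bs; apply: h; rewrite inE bs orbT.
apply: filterS (filterI h1 h2) => i [Qa Qs] b; rewrite inE => /predU1P[->//|]; exact: Qs.
Qed.

(** Translation by -u in logarithmic coordinates: the moduli change, the arguments do not. *)
Lemma shrink_monomial p (u : 'I_n -> R) (q := vec (fun j => zcoord j p * (expR (- u j))%:C%C)) :
  U p -> [/\ U q, forall j, logmod j q = logmod j p - u j
    & forall alpha, monomial alpha p = (expR (dot alpha u))%:C%C * monomial alpha q].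
Proof.
move=> Up.
have e0 (r : R) : (expR r)%:C%C != 0 :> R[i].
  by rewrite eq_complex /= eqxx andbT gt_eqF ?expR_gt0.
have Uq : U q by move=> j; rewrite zcoord_vec mulf_neq0 //; exact: Up.
split=> // [j|alpha].
  rewrite !logmod_normc // zcoord_vec normcM normc_realC ger0_norm ?expR_ge0 //.
  by rewrite lnM ?posrE ?expR_gt0 ?normc_gt0 ?expRK //; exact: Up.
rewrite expR_dot rmorph_prod /= /monomial -big_split /=; apply: eq_bigr => j _.
rewrite fmorphXz -expfzMl zcoord_vec mulrCA -rmorphM /= -expRD addrN expR0 mulr1.
by [].
Qed.

(** Quasi-homogeneity: all monomials with exponents in [P] are scaled by the same factor exp(m). *)
Lemma initial_normsq_scale c (P : pred 'rV[int]_n) p q (m : R) (u : 'I_n -> R) :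
  (forall alpha, monomial alpha p = (expR (dot alpha u))%:C%C * monomial alpha q) ->
  {in finsupp c, forall alpha, P alpha -> dot alpha u = m} ->
  initial_normsq c P p = expR m ^+ 2 * initial_normsq c P q.
Proof.
move=> pq uP; rewrite /initial_normsq mulr_sumr; apply: eq_bigr => a _.
have -> : expR m ^+ 2 = nsq (expR m)%:C%C by rewrite /nsq /= expr0n addr0.
rewrite -nsqM mulr_sumr; congr nsq.
apply: eq_sum_seq_cond => b bc Pb.
by rewrite pq (uP b bc Pb); ring.
Qed.

(** Along each of the 2n frame vectors, the initial part differs from the full derivative by the
    terms off [P]. Both are at most eta S, whence (2 eta S)^2 for each vector. *)
Lemma initial_normsq_le c (P : pred 'rV[int]_n) p (eta W : R) : U p -> 0 < eta -> 0 < W ->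
  (forall a, \sum_(alpha <- finsupp c) normc (c alpha * frame_weight R alpha a) <= W) ->
  nabla_norm g 1 (laurent_eval c) p <= eta * abssum c p ->
  {in finsupp c, forall alpha, ~~ P alpha -> W / eta * absmono alpha p <= abssum c p} ->
  initial_normsq c P p <= ((n + n)%:R * 4 * eta ^+ 2) * abssum c p ^+ 2.
Proof.
move=> Up eta0 W0 hW small neg.
have S0 : 0 <= abssum c p by apply: sumr_ge0 => a _; exact: expR_ge0.
have -> : (n + n)%:R * 4 * eta ^+ 2 * abssum c p ^+ 2 =
    \sum_(a < n + n) (2 * eta * abssum c p) ^+ 2.
  by rewrite sumr_const card_ord -mulr_natl; ring.
apply: ler_sum => a _; rewrite -normc_sqr ler_pXn2r ?nnegrE ?normc_ge0 ?mulr_ge0 ?(ltW eta0) //.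
set Pa := (X in normc X).
pose Ra := \sum_(alpha <- finsupp c | ~~ P alpha) c alpha * (frame_weight R alpha a * monomial alpha p).
have PR : Pa = frame_deriv c [:: a] p - Ra.
  apply/eqP; rewrite eq_sym subr_eq; apply/eqP.
  rewrite /frame_deriv (bigID P) /=; congr (_ + _); apply: eq_bigr => b _; by rewrite big_seq1 mulrA.
have RS : normc Ra <= eta * abssum c p.
  apply: (le_trans (normc_sum _ _ _)).
  apply: (@le_trans _ _ (\sum_(alpha <- finsupp c) normc (c alpha * frame_weight R alpha a) * (eta / W * abssum c p))).
    apply: ler_sum_seq_cond => b bc; last by rewrite !mulr_ge0 ?normc_ge0 ?invr_ge0 ?(ltW eta0) ?(ltW W0).
    move=> nPb; rewrite mulrA normcM normc_monomial // ler_wpM2l ?normc_ge0 //.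
    have := neg b bc nPb; rewrite -[eta / W]invf_div mulrC -ler_pdivlMr ?divr_gt0 //.
    by rewrite mulrC.
  rewrite -mulr_suml; apply: le_trans (ler_wpM2r _ (hW a)) _; first by rewrite !mulr_ge0 ?invr_ge0 ?(ltW eta0) ?(ltW W0).
  by rewrite mulrA mulrCA divff ?mulr1 // gt_eqF.
rewrite PR; apply: (le_trans (le_normcD _ _)); rewrite normcN.
rewrite -mulrA mulr_natl mulr2n; apply: lerD => //.
exact: le_trans (frame_deriv1_le c a Up) small.
Qed.

Lemma nabla_norm_ge c : convenient c -> nondegenerate c ->
  exists2 c0 : R, 0 < c0 & exists D : R, forall p, U p ->
    (exists j, D < `|logmod j p|) ->
    c0 * abssum c p <= nabla_norm g 1 (laurent_eval c) p.
Proof.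
move=> cv nd; apply: contrapT => fails.
(* The negated claim, with constant 1/(i+1) and threshold [i]. *)
have far_small (i : nat) : exists p, [/\ U p, exists j, i%:R < `|logmod j p| &
    nabla_norm g 1 (laurent_eval c) p < i.+1%:R^-1 * abssum c p].
  apply: contrapT => h; apply: fails; exists i.+1%:R^-1; first by rewrite invr_gt0.
  exists i%:R => p Up hj; rewrite leNgt; apply/negP => lt; apply: h.
  by exists p.
have /choice[p hp] := far_small.
have Up i : U (p i) by case: (hp i).
have [G [uG Goo]] := @ultraFilterLemma _ _ eventually_filter.
have Gev N : G [set i | (N <= i)%N] by apply: Goo; exists N.
have Gex (Q Q' : set nat) : G Q -> G Q' -> exists i, Q i /\ Q' i.
  by move=> h h'; exact: (filter_ex (filterI h h')).
have GI (Q Q' : set nat) : G Q -> G Q' -> G (Q `&` Q') by exact: filterI.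
pose A : seq 'rV[int]_n := finsupp c.
pose S i := abssum c (p i); pose E a i := absmono a (p i).
have E0 a i : 0 < E a i by exact: expR_gt0.
have ES a i : a \in A -> E a i <= S i by exact: absmono_le.
(* [S] tends to infinity along [G]: some |log|z_j|| exceeds [i], and [abssum_growth] applies. *)
have Sbig K : G [set i | K < S i].
  have [d d0 growth] := abssum_growth cv.
  apply: filterS (Gev (Num.bound `|K / d|)) => i /= iK.
  have [_ [j hj] _] := hp i.
  apply: lt_le_trans (growth (p i) j); apply: (@lt_le_trans _ _ (d * `|logmod j (p i)|)); last first.
    by apply: le_trans (expR_ge1Dx _); rewrite lerDr.
  rewrite mulrC -ltr_pdivrMr //; apply: le_lt_trans (ler_norm _) _.
  apply: lt_trans hj; apply: (lt_le_trans (archi_boundP (normr_ge0 _))).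
  by rewrite ler_nat.
(* [bd a] means S = O(E a) along [G]; these are the dominant exponents. *)
pose bd a := exists K, G [set i | S i <= K * E a i].
pose P : pred 'rV[int]_n := fun a => `[< bd a >].
have [K K1 hK] : exists2 K : R, 1 <= K &
    G [set i | forall a, a \in A -> P a -> S i <= K * E a i].
  have /choice[kf hkf] : forall a, exists k, P a -> G [set i | S i <= k * E a i].
    move=> a; case: (pselect (bd a)) => [[k hk]|nbd]; first by exists k.
    by exists 0 => /asboolP.
  exists (1 + \sum_(a <- A) `|kf a|); first by rewrite lerDl sumr_ge0.
  apply: filterS (@filter_seq _ _ G _ A (fun a => [set i | P a -> S i <= kf a * E a i]) _).
    move=> i h a aA Pa; apply: le_trans (h a aA Pa) _.
    rewrite ler_wpM2r ?(ltW (E0 _ _)) // (big_rem a) //=.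
    rewrite (le_trans (ler_norm _)) // addrCA lerDl addr_ge0 // sumr_ge0 //.
  move=> a aA; case: (boolP (P a)) => Pa; last by apply: filterS filterT.
  by apply: filterS (hkf a Pa) => i h _; exact: h.
(* For an ultrafilter, failure of S = O(E a) means that [k * E a i < S i] holds along [G] for every
   [k]. *)
have hN k : G [set i | forall a, a \in A -> ~~ P a -> k * E a i < S i].
  apply: (@filter_seq _ _ G _ A (fun a => [set i | ~~ P a -> k * E a i < S i])) => a aA.
  case: (boolP (P a)) => Pa; first by apply: filterS filterT.
  have [h|h] := in_ultra_setVsetC [set i | S i <= k * E a i] uG.
    by case/negP: Pa; apply/asboolP; exists k.
  by apply: filterS h => i /= /negP; rewrite -ltNge.
(* If no exponent were dominant, each term of [S] would be below S / (size A + 1), and [S] could not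
   be their sum. *)
have [a0 a0A Pa0] : exists2 a, a \in A & P a.
  apply: contrapT => nP.
  have [i [h S0]] := Gex _ _ (hN (size A).+1%:R) (Sbig 0).
  have : (size A).+1%:R * S i <= (size A)%:R * S i.
    rewrite {1}/S /abssum mulr_sumr (_ : (size A)%:R * S i = \sum_(a <- A) S i); last first.
      by rewrite big_const_seq count_predT iter_addr_0 mulr_natl.
    rewrite !big_seq; apply: ler_sum => a aA; apply: ltW; apply: h => //.
    by apply/negP => Pa; apply: nP; exists a.
  by rewrite ler_pM2r // ler_nat ltnn.
(* [u i] is killed by [M], i.e. all [alpha] in [P] have the same value on it,
   while [y i] is bounded because [X i *m M] is. *)
pose M : 'M[R]_(n, size A) := \matrix_(j, k)
  if P (nth 0 A k) then (nth 0 A k 0 j)%:~R - (a0 0 j)%:~R else 0.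
pose X i : 'rV[R]_n := \row_j logmod j (p i).
pose y i := X i *m M *m pinvmx M; pose u i := X i - y i.
have XE a i : E a i = expR (dot a (X i 0)).
  by congr expR; apply: eq_bigr => j _; rewrite mxE.
have vM (v : 'rV[R]_n) (k : 'I_(size A)) :
    (v *m M) 0 k = if P (nth 0 A k) then dot (nth 0 A k) (v 0) - dot a0 (v 0) else 0.
  rewrite mxE; under eq_bigr do rewrite mxE.
  case: ifP => _; last by apply: big1 => j _; rewrite mulr0.
  by rewrite /dot -sumrB; apply: eq_bigr => j _; rewrite mulrBr !(mulrC (v 0 j)).
have dot_u i a : a \in A -> P a -> dot a (u i 0) = dot a0 (u i 0).
  move=> aA Pa; have uM : u i *m M = 0.
    by rewrite mulmxBl mulmxKpV ?subrr // submxMl.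
  have ia : (index a A < size A)%N by rewrite index_mem.
  have := vM (u i) (Ordinal ia); rewrite /= nth_index // Pa uM mxE => /esym/eqP.
  by rewrite subr_eq0 => /eqP.
(* The entries of [X i *m M] are logarithms of ratios of dominant monomials, at most ln K in
   absolute value; [B] carries this bound through [pinvmx M]. *)
pose B := ln K * \sum_(k < size A) \sum_(j < n) `|pinvmx M k j|.
have lK : 0 <= ln K by rewrite ln_ge0.
have K0 : 0 < K by apply: lt_le_trans K1.
pose good i := forall a, a \in A -> P a -> S i <= K * E a i.
have E_ratio i a b : good i -> a \in A -> P a -> b \in A -> dot b (X i 0) - dot a (X i 0) <= ln K.
  move=> gi aA Pa bA; rewrite lerBlDr -ler_expR expRD lnK // -!XE.
  exact: le_trans (ES b i bA) (gi a aA Pa).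
have yB i j : good i -> `|y i 0 j| <= B.
  move=> gi; rewrite /B mulr_sumr /y mxE; apply: (le_trans (ler_norm_sum _ _ _)).
  apply: ler_sum => k _; rewrite normrM ler_pM //.
    rewrite vM; case: ifP => Pk; last by rewrite normr0.
    have kA : nth 0 A k \in A by rewrite mem_nth.
    by rewrite ler_norml lerNl opprB !E_ratio.
  by rewrite (bigD1 j) //= lerDl sumr_ge0.
pose T := (\sum_(a <- A) \sum_(j < n) `|(a 0 j)%:~R : R|) * B.
have yT i a : good i -> a \in A -> `|dot a (y i 0)| <= T.
  move=> gi aA; apply: (le_trans (dot_bound a (fun j => yB i j gi))).
  have B0 : 0 <= B by rewrite mulr_ge0 // sumr_ge0 // => k _; exact: sumr_ge0.
  rewrite ler_wpM2r // (big_rem a) //= lerDl sumr_ge0 // => b _; exact: sumr_ge0.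
have Euy a i : E a i = expR (dot a (u i 0)) * expR (dot a (y i 0)).
  rewrite -expRD -dotD XE; congr expR; apply: eq_bigr => j _.
  by rewrite !mxE subrK.
pose em i := expR (dot a0 (u i 0)).
(* S <= K E a0, and E a0 differs from [em] by a factor at most exp(T). *)
pose L := K * expR T.
have L0 : 0 < L by rewrite mulr_gt0 ?expR_gt0.
have em_lo i : good i -> S i <= L * em i.
  move=> gi; apply: le_trans (gi a0 a0A Pa0) _.
  rewrite Euy -/(em i) /L -mulrA ler_pM2l // mulrC ler_pM2r ?expR_gt0 //.
  by rewrite ler_expR; apply: le_trans (ler_norm _) (yT i a0 gi a0A).
(* [P] does not depend on [i], so a single good index exhibits it as a face: L < S <= L em forces
   a0.u > 0, and the factor exp(T) asked of [hN] absorbs a.y, giving a.u < a0.u off [P]. *)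
have pos q : U q -> 0 < initial_normsq c P q.
  have [i [[gi hni] Li]] := Gex _ _ (GI _ _ hK (hN (L * expR T))) (Sbig L).
  have em1 : 1 < em i.
    by rewrite -(ltr_pM2l L0) mulr1 (lt_le_trans Li) // em_lo.
  apply: (@initial_normsq_gt0 _ _ c P (u i) (dot a0 (u i 0)) a0) => //.
  - by rewrite -expR_gt1.
  - by move=> a aA Pa; exact: dot_u.
  - move=> a aA nPa; rewrite -ltr_expR -/(em i) -(ltr_pM2l L0).
    apply: lt_le_trans (em_lo i gi); apply: le_lt_trans (hni a aA nPa).
    rewrite -mulrA ler_pM2l // Euy mulrCA -[leLHS]mulr1 ler_pM2l ?expR_gt0 //.
    rewrite -expRD -expR0 ler_expR -lerBlDl sub0r.
    by have := yT i a gi aA; rewrite ler_norml => /andP[hT _]; lra.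
have [dl dl0 hdl] := initial_normsq_lower (expR (2 * B)) (expR_gt0 (- (2 * B))) pos.
(* Translation by -u i moves [p i] to a point with log-moduli [y i], hence into a fixed annulus,
   where [dl] bounds from below; scaling back costs em^2 >= (S / L)^2. *)
have lower i : good i -> dl / L ^+ 2 * S i ^+ 2 <= initial_normsq c P (p i).
  move=> gi; have [Uq lq mq] := shrink_monomial (u i 0) (Up i).
  rewrite (initial_normsq_scale (c := c) (P := P) (m := dot a0 (u i 0)) mq); last first.
    by move=> a aA Pa; exact: dot_u.
  set q := vec _ in Uq lq mq *; rewrite -/(em i).
  have dq : dl <= initial_normsq c P q.
    apply: hdl; apply: annulusP => // j; rewrite lq.
    by apply: le_trans (yB i j gi); rewrite !mxE opprB addrC subrK.
  have S0 : 0 <= S i by apply: le_trans (ES a0 i a0A); exact: expR_ge0.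
  apply: (@le_trans _ _ (em i ^+ 2 * dl)); last by rewrite ler_pM2l ?exprn_gt0 ?expR_gt0.
  rewrite mulrAC ler_pdivrMr ?exprn_gt0 // [em i ^+ 2 * dl]mulrC -mulrA ler_pM2l // -exprMn.
  rewrite [em i * L]mulrC; have Le := em_lo i gi.
  by rewrite ler_pXn2r ?nnegrE ?(le_trans S0 Le).
pose kappa := dl / L ^+ 2.
have kappa0 : 0 < kappa by rewrite divr_gt0 ?exprn_gt0.
pose N : R := (n + n)%:R * 4 + 1.
have N0 : 0 < N by rewrite ltr_wpDl // mulr_ge0 ?ler0n.
(* Chosen so that 8n eta^2 < N eta^2 <= N eta <= kappa, which contradicts [lower]; the summand 1 in
   [N] makes the first inequality strict. *)
pose eta := Num.min 1 (kappa / N).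
have eta0 : 0 < eta by rewrite lt_min ltr01 divr_gt0.
pose W := 1 + \sum_(a < n + n) \sum_(alpha <- A) normc (c alpha * frame_weight R alpha a).
have W0 : 0 < W by rewrite ltr_wpDr // sumr_ge0 // => a _; rewrite sumr_ge0 // => b _; exact: normc_ge0.
have hW a : \sum_(alpha <- A) normc (c alpha * frame_weight R alpha a) <= W.
  rewrite /W (bigD1 a) //= addrCA lerDl addr_ge0 // sumr_ge0 // => b _.
  by rewrite sumr_ge0 // => d _; exact: normc_ge0.
have [i [[gi hni] [/= S0 ieta]]] :=
  Gex _ _ (GI _ _ hK (hN (W / eta))) (GI _ _ (Sbig 0) (Gev (Num.bound eta^-1))).
have [_ _ small] := hp i.
have : initial_normsq c P (p i) <= ((n + n)%:R * 4 * eta ^+ 2) * S i ^+ 2.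
  apply: (initial_normsq_le (Up i) eta0 W0 hW); last by move=> a aA nPa; apply/ltW/hni.
  apply: (le_trans (ltW small)); rewrite ler_pM2r // -[leRHS]invrK lef_pV2 ?posrE ?invr_gt0 //.
  apply: (le_trans (ltW (archi_boundP (ltW _)))); first by rewrite invr_gt0.
  by rewrite ler_nat (leq_trans ieta).
apply/negP; rewrite -ltNge; apply: lt_le_trans (lower i gi).
rewrite ltr_pM2r ?exprn_gt0 // -/kappa.
apply: (@lt_le_trans _ _ (N * eta ^+ 2)).
  by rewrite ltr_pM2r ?exprn_gt0 // ltrDl ltr01.
apply: (@le_trans _ _ (N * eta)).
  by rewrite ler_pM2l // expr2 -[leRHS]mulr1 ler_pM2l // ge_min lexx.
by rewrite mulrC -ler_pdivlMr // ge_min lexx orbT.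
Qed.

(** Near infinity the difference is at least kappa S^2 - C S, because S >= 1 and k >= 2 give S^k >=
    S^2. *)
Lemma strongly_elliptic_torus c : convenient c -> nondegenerate c ->
  strongly_elliptic U g (laurent_eval c).
Proof.
move=> cv nd eps k z0 eps0 k2 Uz0 M.
have [C C0 up] := nabla_norm_le c k.
have [c0 c00 [D0 lo]] := nabla_norm_ge cv nd.
have [d d0 growth] := abssum_growth cv.
pose kappa := eps * c0 ^+ k.
have kappa0 : 0 < kappa by rewrite mulr_gt0 ?exprn_gt0.
(* S >= S0 ensures both S >= 1 and kappa S - C >= |M| + 1; the threshold S0 / d yields S >= S0
   through exp(t) >= 1 + t. *)
pose S0 := 1 + (C + `|M| + 1) / kappa.
have [D hD] := far_point (Num.max D0 (S0 / d)) Uz0.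
exists D => z Uz /(hD z Uz) [j]; rewrite gt_max => /andP[jD0 jS].
have lz := lo z Uz (ex_intro _ j jD0); have uz := up z Uz.
set S := abssum c z in lz uz.
have SS0 : S0 <= S.
  apply: le_trans (growth z j); apply: le_trans (expR_ge1Dx _).
  by rewrite ltr_pdivrMr // mulrC in jS; rewrite (le_trans (ltW jS)) // lerDr.
have q0 : 0 <= (C + `|M| + 1) / kappa by rewrite divr_ge0 ?(ltW kappa0) // !addr_ge0.
have S1 : 1 <= S by apply: le_trans SS0; rewrite lerDl.
have Sp : 0 <= S by apply: le_trans S1.
apply: (@lt_le_trans _ _ (kappa * S ^+ 2 - C * S)); last first.
  apply: lerB => //; rewrite -mulrA ler_pM2l //.
  apply: (@le_trans _ _ ((c0 * S) ^+ k)).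
    by rewrite exprMn ler_pM2l ?exprn_gt0 // ler_weXn2l.
  by rewrite lerXn2r ?nnegrE ?mulr_ge0 ?(ltW c00) ?sqrtr_ge0.
have kS : C + `|M| + 1 <= kappa * S.
  rewrite mulrC -ler_pdivrMr //; apply: le_trans SS0; by rewrite lerDr.
have Mn := ler_norm M.
rewrite (_ : _ - _ = S * (kappa * S - C)); last by ring.
apply: (@lt_le_trans _ _ (`|M| + 1)); first by rewrite ltr_pwDr.
have h : `|M| + 1 <= kappa * S - C by rewrite lerBrDl addrA.
by rewrite -[leLHS]mul1r ler_pM // addr_ge0.
Qed.

End LowerBound.

Theorem theorem2p18 (R : realType) (n : nat) (f : laurent R n) :
  convenient f -> nondegenerate f ->
  bounded_geometry (@torus R n) (@torus_metric R n) /\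
  strongly_elliptic (@torus R n) (@torus_metric R n) (laurent_eval f).
Proof.
move=> cf nf; split; first exact: bounded_geometry_torus.
exact: strongly_elliptic_torus.
Qed.
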